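(* Let $\mathbf r,\mathbf c\in\mathbb Z_{>0}^3$ with $r_1+r_2+r_3=c_1+c_2+c_3$, and let $\operatorname{T}_{\mathbf r\mathbf c}$ be the corresponding $3\times3$ transportation polytope. If $\operatorname{T}_{\mathbf r\mathbf c}$ is not a multiple of the Birkhoff polytope $B_3$ (i.e. it is not the case that $\mathbf r=\mathbf c=(k,k,k)$ for some positive integer $k$), then $\operatorname{T}_{\mathbf r\mathbf c}$ has a quadratic triangulation.
   Context: The $3\times3$ transportation polytope $\operatorname{T}_{\mathbf r\mathbf c}\subset\mathbb R^{9}$ is the set of all real nonnegative $3\times3$ matrices with row sums $r_1,r_2,r_3$ and column sums $c_1,c_2,c_3$; it is a lattice polytope with respect to $\mathbb Z^9$. $B_3=\operatorname{T}_{(1,1,1),(1,1,1)}$. For a triangulation of a lattice polytope $P$ with vertices among the lattice points $P\cap\mathbb Z^d$, a subset $F\subseteq P\cap\mathbb Z^d$ is a face if $\operatorname{conv}(F)$ is a simplex of the triangulation, and a non-face otherwise. A quadratic triangulation of $P$ is a regular (i.e. induced by a height function on the lattice points) unimodular (every maximal simplex has normalized volume $1$ with respect to the lattice of the affine span of $P$) triangulation of $P$ with vertices in $P\cap\mathbb Z^d$, all of whose minimal non-faces have exactly two elements. *)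

(* Defs.v *)
From HB Require Import structures.
From mathcomp Require Import all_boot all_order all_algebra finmap.
From mathcomp Require Import all_classical all_reals.

Set Implicit Arguments.
Unset Strict Implicit.
Unset Printing Implicit Defensive.
Import Order.TTheory GRing.Theory Num.Theory.
Local Open Scope fset_scope.
Local Open Scope classical_set_scope.
Local Open Scope ring_scope.

Section Hulls.
Variables (R : realType) (V : lmodType R).
Implicit Types (X : set V) (F : {fset V}).

Definition convex_hull X : set V :=
  [set x | exists n (v : 'I_n -> V) (w : 'I_n -> R),
     [/\ forall i, X (v i), forall i, 0 <= w i,
         \sum_i w i = 1 & x = \sum_i w i *: v i]].

Definition affine_span X : set V :=
  [set x | exists n (v : 'I_n -> V) (w : 'I_n -> R),
     [/\ forall i, X (v i), \sum_i w i = 1 & x = \sum_i w i *: v i]].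

Definition affinely_independent F : Prop :=
  forall w : V -> R,
    \sum_(v <- F) w v = 0 -> \sum_(v <- F) w v *: v = 0 ->
    forall v, v \in F -> w v = 0.

End Hulls.

(* The lattice [L] is the ambient one ([Z^d] for a lattice polytope in [R^d]),
   [P] is the polytope.  A simplex is represented by its finite set of
   vertices, and a triangulation by the set [T] of all its simplices, of all
   dimensions and including the empty one. *)
Section Triangulations.
Variables (R : realType) (V : lmodType R) (L P : set V).
Implicit Types (F G H : {fset V}) (T : set {fset V}).

Definition triangulation T : Prop :=
  [/\ forall G, T G -> [set` G] `<=` P `&` L /\ affinely_independent G,
      forall G H, T G -> (H `<=` G)%fset -> T H,
      forall G H, T G -> T H ->
        convex_hull [set` G] `&` convex_hull [set` H]
        = convex_hull [set` (G `&` H)%fset]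
    & \bigcup_(G in T) convex_hull [set` G] = P].

Definition lifted_polytope (h : V -> R) : set (V * R^o)%type :=
  @convex_hull R (V * R^o)%type [set (a, h a) | a in P `&` L].

(* The faces of the lifted polytope selected by an inner normal vector whose
   last coordinate is positive, normalized to 1. *)
Definition lower_face (h : V -> R) (Q : set (V * R^o)%type) : Prop :=
  exists phi : {scalar V},
    Q = [set x | lifted_polytope h x /\
         forall y, lifted_polytope h y -> phi x.1 + x.2 <= phi y.1 + y.2].

Definition regular T : Prop :=
  exists h : V -> R, forall X : set V, X !=set0 ->
    (exists2 G, T G & X = convex_hull [set` G]) <->
    (exists2 Q, lower_face h Q & X = [set x.1 | x in Q]).

(* The lattice of the affine span of [P], translated to the origin. *)
Definition span_lattice : set V :=
  [set x - y | x in affine_span P `&` L & y in affine_span P `&` L].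

Definition span_lattice_basis n (b : 'I_n -> V) : Prop :=
  (forall j, span_lattice (b j)) /\
  (forall x, span_lattice x ->
     exists! z : 'rV[int]_n, x = \sum_j (z 0 j)%:~R *: b j).

(* In coordinates with respect to a basis of the lattice, the simplex with
   vertices v_0, ..., v_n has Euclidean volume |det C| / n!, where the rows of
   C are the coordinates of the edge vectors v_i - v_0. *)
Definition normalized_volume G (q : R) : Prop :=
  exists n (b : 'I_n -> V) (v : 'I_n.+1 -> V) (C : 'M[R]_n),
    [/\ span_lattice_basis b, [set` G] = range v,
        forall i, v (lift ord0 i) - v ord0 = \sum_j C i j *: b j
      & q = `|\det C|].

Definition unimodular T : Prop :=
  forall G, T G -> (forall H, T H -> (G `<=` H)%fset -> H = G) ->
    normalized_volume G 1.

Definition face T F : Prop :=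
  exists2 G, T G & convex_hull [set` F] = convex_hull [set` G].

Definition minimal_non_face T F : Prop :=
  [/\ [set` F] `<=` P `&` L, ~ face T F
    & forall H, (H `<` F)%fset -> face T H].

Definition quadratic_triangulation T : Prop :=
  [/\ triangulation T, regular T, unimodular T
    & forall F, minimal_non_face T F -> #|` F| = 2%N].

End Triangulations.

Definition integer_matrices (R : realType) m n : set 'M[R]_(m, n) :=
  [set M | forall i j, M i j \is a Num.int].

Definition transportation_polytope (R : realType) m n
    (r : 'I_m -> int) (c : 'I_n -> int) : set 'M[R]_(m, n) :=
  [set M | [/\ forall i j, 0 <= M i j,
               forall i, \sum_j M i j = (r i)%:~R
             & forall j, \sum_i M i j = (c j)%:~R]].

(* Main.v *)
Require Import Defs.
From HB Require Import structures.
From mathcomp Require Import all_boot all_order all_algebra finmap.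
From mathcomp Require Import all_classical all_reals.
From mathcomp Require Import zify ring lra.

(** Let [i0] be a row with [r i0 >= 2] and let [i1], [i2] be the other rows.
    Lift a lattice point [M] to the height
      100 (|M i1|^2 + |M i2|^2) + 2 (M i1 2 - M i1 1) (M i2 1 - M i2 0).
    Call two lattice points compatible if no pair of lattice points with the
    same sum has smaller total height. The simplices are the cliques of
    compatible points, so that minimal non-faces are incompatible pairs, and
    a point of the polytope lies in the clique supporting its convex weighting
    of minimal height. Everything else follows once every nonempty clique is
    exposed, i.e. is the exact contact set of an affine function with the
    height from below: uniqueness of the weighting, affine independence, and
    regularity.

    The quadratic part of the height forces row [i1] of the members of a clique
    into a unit triangle, and likewise row [i2]. Hence a clique lies in the
    product of two triangles, whose nine vertices are indexed by the edges of
    K_{3,3}; the inequalities on row [i0] cut away some of these vertices, in one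
    of finitely many patterns. For each pattern the cliques are exposed, by
    computation, with a single exception: the six vertices of a translate of
    the Birkhoff polytope, for which row [i0] would have sum 1. Unimodularity
    holds because affine dependencies between the vertices of the product are
    cycles of K_{3,3}. *)

Import Order.TTheory GRing.Theory Num.Theory.
Set Implicit Arguments.
Unset Strict Implicit.
Unset Printing Implicit Defensive.

(** * A finite check on products of two triangles *)

Definition grid : seq (nat * nat) := allpairs pair (iota 0 3) (iota 0 3).

(* The weight 2 u_i v_j, with u = (0, -1, 1) and v = (-1, 1, 0), or its opposite
   if [s] is false, shifted by 2 to be a natural number. The factor 2 leaves
   room for integral potentials. *)
Definition cell_weight_nat (s : bool) (p : nat * nat) : nat :=
  let z := nth 2 (nth [::] [:: [::]; [:: 4; 0; 2]; [:: 0; 4; 2]] p.1) p.2 in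
  if s then z else 4 - z.

(* [s1] and [s2] tell whether the two unit triangles have vertices [m + e_k]
   (true) or [m - e_k] (false); [g] is the upper bound on the sum of the two
   vertices, shifted by 1 in every coordinate for each downward triangle. *)
Definition in_cell (s1 s2 : bool) (g : seq nat) (p : nat * nat) : bool :=
  all (fun k => ((p.1 == k) == s1) + ((p.2 == k) == s2) <= nth 0 g k) (iota 0 3).

(** The pairs [p], [q] and [(p.1, q.2)], [(q.1, p.2)] index points with the same sum, so this tests
    compatibility against a single competing pair. It is a necessary condition, and cliques for it
    include all that have to be exposed. *)
Definition swap_ok (s : bool) (K : seq (nat * nat)) (p q : nat * nat) : bool :=
  [&& (p.1, q.2) \in K & (q.1, p.2) \in K] ==>
  (cell_weight_nat s p + cell_weight_nat s q <=
   cell_weight_nat s (p.1, q.2) + cell_weight_nat s (q.1, p.2)).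

Fixpoint swap_cliques (s : bool) (K l : seq (nat * nat)) : seq (seq (nat * nat)) :=
  if l is p :: l' then
    let c := swap_cliques s K l' in
    c ++ [seq p :: F | F <- c & all (swap_ok s K p) F]
  else [:: [::]].

(* One Bellman-Ford round for the system [y_j - x_i <= w_ij] on [K], with
   equality exactly on [F]. *)
Definition relax s (K F : seq (nat * nat)) (xy : seq nat * seq nat) :=
  let x := [seq foldr maxn (nth 0 xy.1 i)
      [seq nth 0 xy.2 p.2 + 2 + (p \notin F) - cell_weight_nat s p
         | p <- K & p.1 == i] | i <- iota 0 3] in
  let y := [seq foldr maxn (nth 0 xy.2 j)
      [seq nth 0 x p.1 + cell_weight_nat s p - 2
         | p <- F & p.2 == j] | j <- iota 0 3] in
  (x, y).

(** The [+ 2] undoes the shift in [cell_weight_nat]. The bound 12 keeps the potentials small against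
    the factor 100 of the height. *)
Definition exposed_by s (K F : seq (nat * nat)) (x y : seq nat) : bool :=
  all (fun p => (nth 0 y p.2 + 2 <= cell_weight_nat s p + nth 0 x p.1) &&
    ((nth 0 y p.2 + 2 == cell_weight_nat s p + nth 0 x p.1) == (p \in F))) K
  && all (leq^~ 12) (x ++ y).

(** The three rounds of [relax] only propose potentials; [exposed_by] certifies them, so soundness
    does not rest on convergence of the iteration. *)
Definition exposure_check (s1 s2 : bool) (g : seq nat) : bool :=
  let s := s1 == s2 in
  let K := [seq p <- grid | in_cell s1 s2 g p] in
  all (fun F => let xy := iter 3 (relax s K F) ([:: 0; 0; 0], [:: 0; 0; 0]) in
         exposed_by s K F xy.1 xy.2) (swap_cliques s K K).

(* The excluded pattern consists of the six vertices of the Birkhoff polytope. *)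
Lemma exposure_checkP :
  all (fun s1 => all (fun s2 => all (fun g0 => all (fun g1 => all (fun g2 =>
     [&& s1, s2 & [:: g0; g1; g2] == [:: 1; 1; 1]]
     || exposure_check s1 s2 [:: g0; g1; g2])
  (iota 0 3)) (iota 0 3)) (iota 0 3)) [:: true; false]) [:: true; false].
Proof. by vm_compute. Qed.

Local Open Scope fset_scope.
Local Open Scope classical_set_scope.
Local Open Scope ring_scope.

(** * Weightings of minimal height *)

Lemma exists_argmin (R : realDomainType) (I : eqType) (s : seq I) (f : I -> R) i0 :
  i0 \in s -> exists2 i, i \in s & forall j, j \in s -> f i <= f j.
Proof.
elim: s i0 => // a s IH i0 _; case: s IH => [_|b s IH].
  by exists a; rewrite ?inE // => j; rewrite inE => /eqP ->.
have [i si imin] := IH b (mem_head _ _).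
have [ai|ia] := leP (f a) (f i).
  exists a => [|j]; rewrite ?mem_head // inE => /predU1P[->//|/imin].
  exact: le_trans.
exists i => [|j]; rewrite inE ?si ?orbT // => /predU1P[->|/imin//].
exact: ltW.
Qed.

Section WeightedSums.
Variables (R : realType) (V : lmodType R).
Implicit Types (A G : {fset V}) (w : V -> R).

Lemma sum_fset_delta (W : lmodType R) A (g : V -> W) p :
  p \in A -> \sum_(a <- A) (a == p)%:R *: g a = g p.
Proof.
move=> pA; rewrite (big_fsetD1 p) //= eqxx scale1r big1_fset ?addr0 // => a.
by rewrite !inE => /andP[/negPf -> _]; rewrite scale0r.
Qed.

(** Adds up the weights of equal members of the family [v], turning an indexed combination with
    repetitions into one over the finite set [A]. *)
Lemma sum_fset_collect (W : lmodType R) A (g : V -> W) n (v : 'I_n -> V)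
    (u : 'I_n -> R) : (forall i, v i \in A) ->
  \sum_(a <- A) (\sum_i u i * (a == v i)%:R) *: g a = \sum_i u i *: g (v i).
Proof.
move=> vA; under eq_bigr do rewrite scaler_suml.
rewrite exchange_big /=; apply: eq_bigr => i _.
under eq_bigr do rewrite -scalerA.
by rewrite -scaler_sumr sum_fset_delta.
Qed.

Lemma sum_fset_collect1 A n (v : 'I_n -> V) (u : 'I_n -> R) :
  (forall i, v i \in A) ->
  \sum_(a <- A) (\sum_i u i * (a == v i)%:R) = \sum_i u i.
Proof.
move=> vA; under eq_bigr do rewrite -[\sum_i _]mulr1.
under [RHS]eq_bigr do rewrite -[u _]mulr1.
exact: (@sum_fset_collect R^o A (fun=> 1)).
Qed.

Definition weighting A w := (forall v, 0 <= w v) /\ \sum_(a <- A) w a = 1.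

(** The map [g] is the identity for hulls in [V] and [a] to [(a, h a)] for the lifted polytope. *)
Lemma convex_hull_image (W : lmodType R) A (g : V -> W) y :
  @convex_hull R W [set g a | a in [set` A]] y <->
  exists2 w, weighting A w & y = \sum_(a <- A) w a *: g a.
Proof.
split=> [[n [v [u [vA u0 u1 ->]]]]|[w [w0 w1] ->]].
  have /choice[f fP] i : exists a, a \in A /\ g a = v i.
    by have [a aA <-] := vA i; exists a.
  have fA i : f i \in A by case: (fP i).
  exists (fun a => \sum_i u i * (a == f i)%:R).
    split=> [a|]; first by apply: sumr_ge0 => i _; rewrite mulr_ge0.
    by rewrite sum_fset_collect1.
  rewrite sum_fset_collect //; apply: eq_bigr => i _.
  by case: (fP i) => _ ->.
pose v (i : 'I_(size A)) := nth 0 A i.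
have vA i : v i \in A by rewrite mem_nth.
exists (size A), (g \o v), (w \o v); split=> [i|i| |]; rewrite /= ?w0 //.
- by exists (v i); rewrite //= vA.
- by rewrite -[RHS]w1 (big_nth 0) big_mkord.
- by rewrite (big_nth 0) big_mkord.
Qed.

Lemma convex_hullP A x : convex_hull [set` A] x <->
  exists2 w, weighting A w & x = \sum_(a <- A) w a *: a.
Proof. by rewrite -(convex_hull_image A id) image_id. Qed.

Lemma affine_spanP A x : affine_span [set` A] x <->
  exists2 w, \sum_(a <- A) w a = 1 & x = \sum_(a <- A) w a *: a.
Proof.
split=> [[n [v [u [vA u1 ->]]]]|[w w1 ->]].
  exists (fun a => \sum_i u i * (a == v i)%:R); last first.
    by rewrite (@sum_fset_collect V A id).
  by rewrite sum_fset_collect1.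
pose v (i : 'I_(size A)) := nth 0 A i.
exists (size A), v, (w \o v); split=> [i| |] /=.
- exact: mem_nth.
- by rewrite -[RHS]w1 (big_nth 0) big_mkord.
- by rewrite (big_nth 0) big_mkord.
Qed.

Lemma sum_fset_restrict (W : lmodType R) A G (w : V -> R) (g : V -> W) :
  (G `<=` A)%fset -> (forall a, a \in A -> a \notin G -> w a = 0) ->
  \sum_(a <- A) w a *: g a = \sum_(a <- G) w a *: g a.
Proof.
move=> GA w0; apply/esym/big_fset_incl => // a aA aG.
by rewrite w0 // scale0r.
Qed.

Lemma sum_fset_restrict1 A G (w : V -> R) :
  (G `<=` A)%fset -> (forall a, a \in A -> a \notin G -> w a = 0) ->
  \sum_(a <- A) w a = \sum_(a <- G) w a.
Proof. by move=> GA w0; apply/esym/big_fset_incl => // a aA /w0 ->. Qed.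

End WeightedSums.

Section MinimalWeighting.
Variables (R : realType) (V : lmodType R) (A : {fset V}) (h : V -> R).
Implicit Types (w : V -> R) (x : V).

Definition represents w x := weighting A w /\ x = \sum_(a <- A) w a *: a.
Definition height w := \sum_(a <- A) w a * h a.
Definition supp w : {fset V} := [fset a in A | w a != 0].

Lemma suppP w a : (a \in supp w) = (a \in A) && (w a != 0).
Proof. by rewrite !inE. Qed.

Lemma supp_sub w : (supp w `<=` A)%fset.
Proof. by apply/fsubsetP => a; rewrite suppP => /andP[]. Qed.

Lemma supp0 w a : a \in A -> a \notin supp w -> w a = 0.
Proof. by rewrite suppP => -> /=; rewrite negbK => /eqP. Qed.

(** Resetting the weights outside [A] to 0 keeps them nonnegative everywhere, as [weighting]
    demands. *)
Lemma represents_shift w x (l : V -> R) t : represents w x ->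
  (forall a, a \in A -> 0 <= w a + t * l a) ->
  \sum_(a <- A) l a = 0 -> \sum_(a <- A) l a *: a = 0 ->
  let w' a := if a \in A then w a + t * l a else 0 in
  represents w' x /\ height w' = height w + t * \sum_(a <- A) l a * h a.
Proof.
move=> [[w0 w1 ->]] wl l0 la0 w'.
have w'E (W : lmodType R) (g : V -> W) : \sum_(a <- A) w' a *: g a =
    \sum_(a <- A) w a *: g a + t *: \sum_(a <- A) l a *: g a.
  rewrite scaler_sumr -big_split big_seq [RHS]big_seq.
  by apply: eq_bigr => a aA; rewrite /w' aA scalerDl scalerA.
split; last exact: (w'E R^o h).
split; last by rewrite (w'E V id) la0 scaler0 addr0.
split=> [a|]; first by rewrite /w'; case: ifP => // /wl.
transitivity (\sum_(a <- A) w a + t * \sum_(a <- A) l a); last first.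
  by rewrite l0 mulr0 addr0.
rewrite mulr_sumr -big_split big_seq [RHS]big_seq.
by apply: eq_bigr => a aA; rewrite /w' aA.
Qed.

(* Moving along an affine dependency of the support that does not increase
   the height, until some weight vanishes. *)
Lemma affinely_independent_support w x : represents w x ->
  exists w', [/\ represents w' x, height w' <= height w
               & affinely_independent (supp w')].
Proof.
have [n] := ubnP #|` supp w|; elim: n w => // n IH w sn rw.
have [ai|/existsNP[l]] := pselect (affinely_independent (supp w)).
  by exists w.
move=> /not_implyP[l0] /not_implyP[la0] /existsNP[v /not_implyP[vS lv]].
wlog lh : l l0 la0 lv / \sum_(a <- supp w) l a * h a <= 0.
  move=> wl; have [|/ltW lh] := leP (\sum_(a <- supp w) l a * h a) 0.
    exact: wl.
  apply: (wl (fun a => - l a)).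
  - by rewrite sumrN l0 oppr0.
  - by under eq_bigr do rewrite scaleNr; rewrite sumrN la0 oppr0.
  - by move/eqP; rewrite oppr_eq0 => /eqP.
  - by under eq_bigr do rewrite mulNr; rewrite sumrN oppr_le0.
have [u uS lu] : exists2 u, u \in supp w & l u < 0.
  apply: contrapT => /forall2NP nl.
  have lge0 a : a \in supp w -> 0 <= l a.
    by move=> aS; case: (nl a) => [/(_ aS)//|/negP]; rewrite -leNgt.
  move/eqP: l0; rewrite big_seq psumr_eq0 // => /allP /(_ v vS).
  by rewrite vS => /eqP.
pose s := [seq a <- supp w | l a < 0].
have us : u \in s by rewrite mem_filter lu.
have [z zs zmin] := exists_argmin (fun a => w a / - l a) us.
move: zs; rewrite mem_filter => /andP[lz zS].
(* Ratio test: [t] is the largest step that keeps all weights nonnegative, and it cancels the weight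
   of [z]. *)
pose t := w z / - l z; pose l' a := if a \in supp w then l a else 0.
have t0 : 0 <= t.
  by rewrite divr_ge0 ?oppr_ge0 ?(ltW lz) //; case: rw => -[].
have l'0 a : a \in A -> a \notin supp w -> l' a = 0.
  by move=> _ /negPf; rewrite /l' => ->.
have l'E (W : lmodType R) (g : V -> W) :
    \sum_(a <- A) l' a *: g a = \sum_(a <- supp w) l a *: g a.
  rewrite (sum_fset_restrict _ (supp_sub w)) // big_seq [RHS]big_seq.
  by apply: eq_bigr => a aS; rewrite /l' aS.
have [||| rw' hw'] := represents_shift (l := l') (t := t) rw.
- move=> a aA; rewrite /l'; case: ifPn => [aS|_]; last first.
    by rewrite mulr0 addr0; case: rw => -[].
  have [la|la] := ltP (l a) 0; last first.
    by apply: addr_ge0; [case: rw => -[] | exact: mulr_ge0].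
  have := zmin a; rewrite mem_filter la => /(_ aS).
  rewrite -/t ler_pdivlMr ?oppr_gt0 // mulrN => tl.
  by rewrite -lerBlDr sub0r.
- rewrite (sum_fset_restrict1 (supp_sub w) l'0) -[RHS]l0 big_seq [RHS]big_seq.
  by apply: eq_bigr => a aS; rewrite /l' aS.
- by rewrite (l'E V id).
set w' := (X in represents X x) in rw' hw'.
have w'z : w' z = 0.
  rewrite /w' (fsubsetP (supp_sub w) _ zS) /l' zS /t invrN mulrN mulNr.
  by rewrite divfK ?subrr // lt_eqF.
have s'n : (#|` supp w'| < n)%N.
  apply: leq_trans (_ : #|` supp w| <= n)%N => //.
  apply/fproper_ltn_card; rewrite fproperE; apply/andP; split.
    apply/fsubsetP => a; rewrite !suppP => /andP[aA]; rewrite aA /w' aA /l' suppP aA /=.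
    by case: (eqVneq (w a) 0) => //= ->; rewrite mulr0 addr0 eqxx.
  by apply/fsubsetPn; exists z; rewrite // suppP w'z eqxx andbF.
have [w2 [rw2 hw2 aiw2]] := IH _ s'n rw'.
exists w2; split=> //; apply: le_trans hw2 _; rewrite hw' gerDl.
by rewrite mulr_ge0_le0 // (l'E R^o h).
Qed.

(** Only weightings with affinely independent support compete. Such a support determines the
    weighting of [x], so there is at most one candidate height for each subset of [A], and a finite
    minimum remains. *)
Lemma minimal_weighting x : (exists w, represents w x) ->
  exists2 w, represents w x &
    forall w', represents w' x -> height w <= height w'.
Proof.
pose Q S w := [/\ represents w x, supp w = S & affinely_independent S].
have Q1 S w w' : Q S w -> Q S w' -> height w = height w'.
  move=> [[[w0 w1] wx] wS ai] [[[w'0 w'1] w'x] w'S _].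
  have SA : (S `<=` A)%fset by rewrite -wS supp_sub.
  have d0 a : a \in A -> a \notin S -> w a - w' a = 0.
    move=> aA aS; rewrite !supp0 ?subrr //; first by rewrite w'S.
    by rewrite wS.
  have dS a : a \in S -> w a - w' a = 0.
    apply: (ai (fun a => w a - w' a)).
      by rewrite -(sum_fset_restrict1 SA d0) sumrB w1 w'1 subrr.
    rewrite -(sum_fset_restrict id SA d0).
    by under eq_bigr do rewrite scalerBl; rewrite sumrB -wx -w'x subrr.
  rewrite /height big_seq [RHS]big_seq; apply: eq_bigr => a aA.
  have [/dS|/(d0 _ aA)] := boolP (a \in S);
    by move/eqP; rewrite subr_eq0 => /eqP ->.
have /choice[f fP] S : exists w, (exists w', Q S w') -> Q S w.
  have [[w Qw]|nQ] := pselect (exists w', Q S w'); first by exists w.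
  by exists (fun=> 0) => /nQ.
move=> [w0 rw0].
pose s := [seq S <- fpowerset A | `[<exists w, Q S w>]].
have key w : represents w x -> exists2 S, S \in s & height (f S) <= height w.
  move=> /affinely_independent_support[w' [rw' hw' aiw']].
  have Qw' : exists w, Q (supp w') w by exists w'.
  exists (supp w'); last by rewrite (Q1 _ _ w' (fP _ Qw')).
  by rewrite mem_filter fpowersetE supp_sub andbT; apply/asboolP.
have [S0 S0s _] := key _ rw0.
have [S Ss Smin] := exists_argmin (height \o f) S0s.
move: Ss; rewrite mem_filter => /andP[/asboolP /fP[rfS _ _] _].
exists (f S) => // w /key[S' /Smin hS']; exact: le_trans.
Qed.

End MinimalWeighting.

(** * Triangulations by cliques of compatible points *)

Section QuadraticCriterion.
Variables (R : realType) (V : lmodType R) (L P : set V).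
Variables (A : {fset V}) (h : V -> R).
Implicit Types (F G H : {fset V}) (w : V -> R) (x : V).

Definition compatible p q := forall p' q', p' \in A -> q' \in A ->
  p + q = p' + q' -> h p + h q <= h p' + h q'.

(** The condition [p != q] makes every single point of [A] a clique, so that an obstruction always
    consists of two distinct points. *)
Definition clique G := (G `<=` A)%fset /\
  forall p q, p \in G -> q \in G -> p != q -> compatible p q.

(** The affine function [t - phi] is a minorant of [h] on [A] with contact set [G]. *)
Definition exposes (phi : {scalar V}) t G := forall a, a \in A ->
  t <= phi a + h a /\ (phi a + h a == t) = (a \in G).

Hypothesis latticeA : P `&` L = [set` A].
Hypothesis hullA : P = convex_hull [set` A].
Hypothesis A_neq0 : A != fset0.
Hypothesis exposedA : forall G, clique G -> G != fset0 ->
  exists phi : {scalar V}, exists t, exposes phi t G.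
Hypothesis integralA : forall G w, clique G -> \sum_(g <- G) w g = 1 ->
  L (\sum_(g <- G) w g *: g) -> forall g, g \in G -> w g \is a Num.int.

Lemma scalar_sum (phi : {scalar V}) F w :
  phi (\sum_(a <- F) w a *: a) = \sum_(a <- F) w a * phi a.
Proof. by rewrite linear_sum; apply: eq_bigr => a _; rewrite linearZ. Qed.

Lemma clique_sub G H : clique G -> (H `<=` G)%fset -> clique H.
Proof.
move=> [GA Gc] HG; split; first exact: fsubset_trans GA.
by move=> p q pH qH; apply: Gc; apply: (fsubsetP HG).
Qed.

Lemma clique1 a : a \in A -> clique [fset a].
Proof.
move=> aA; split; first by apply/fsubsetP => b; rewrite inE => /eqP ->.
by move=> p q; rewrite !inE => /eqP -> /eqP ->; rewrite eqxx.
Qed.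

Lemma hull_represents G x : (G `<=` A)%fset ->
  convex_hull [set` G] x <->
  exists2 w, represents A w x & (supp A w `<=` G)%fset.
Proof.
move=> GA; split=> [/convex_hullP[w [w0 w1] ->]|[w [[w0 w1] ->] wG]].
  pose w' a := if a \in G then w a else 0.
  have w'0 a : a \in A -> a \notin G -> w' a = 0.
    by rewrite /w' => _ /negPf ->.
  exists w'; last first.
    by apply/fsubsetP => a; rewrite suppP /w'; case: ifP; rewrite ?eqxx ?andbF.
  split; first split.
  - by move=> a; rewrite /w'; case: ifP.
  - rewrite (sum_fset_restrict1 GA w'0) -[RHS]w1 big_seq [RHS]big_seq.
    by apply: eq_bigr => a aG; rewrite /w' aG.
  rewrite (sum_fset_restrict _ GA w'0) // big_seq [RHS]big_seq.
  by apply: eq_bigr => a aG; rewrite /w' aG.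
have w0' a : a \in A -> a \notin G -> w a = 0.
  by move=> aA aG; apply: (@supp0 _ _ A) => //; apply: contra aG; apply: (fsubsetP wG).
apply/convex_hullP; exists w; last exact: sum_fset_restrict.
by split; rewrite // -(sum_fset_restrict1 GA w0').
Qed.

Lemma hullN0 G x : convex_hull [set` G] x -> G != fset0.
Proof.
move=> /convex_hullP[w [_ w1] _]; apply/eqP => G0; move: w1.
by rewrite G0 big_seq_fset0 => /esym/eqP; rewrite oner_eq0.
Qed.

(** Complementary slackness: [phi x + height A h w - t] is the [w]-weighted sum of the slacks
    [phi a + h a - t], which are nonnegative and vanish exactly on [G]. *)
Lemma exposes_height phi t G w x : exposes phi t G -> represents A w x ->
  t <= phi x + height A h w /\
  (phi x + height A h w = t -> (supp A w `<=` G)%fset) /\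
  ((supp A w `<=` G)%fset -> phi x + height A h w = t).
Proof.
move=> e [[w0 w1] ->].
have -> : phi (\sum_(a <- A) w a *: a) + height A h w =
    t + \sum_(a <- A) w a * (phi a + h a - t).
  under [in RHS]eq_bigr do rewrite mulrBr mulrDr.
  rewrite big_split big_split /= sumrN -mulr_suml w1 mul1r scalar_sum.
  by rewrite /height; ring.
have ge0 a : a \in A -> 0 <= w a * (phi a + h a - t).
  by move=> /e[le _]; rewrite mulr_ge0 // subr_ge0.
have sge0 : 0 <= \sum_(a <- A) w a * (phi a + h a - t).
  by rewrite big_seq; apply: sumr_ge0.
split; first by rewrite lerDl.
split=> [|wG].
  move/eqP; rewrite -subr_eq0 addrC addKr => /eqP s0; apply/fsubsetP => a.
  rewrite suppP => /andP[aA wa]; move/eqP: s0.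
  rewrite big_seq psumr_eq0 // => /allP /(_ a aA).
  by rewrite aA mulf_eq0 (negPf wa) /= subr_eq0 (e a aA).2.
rewrite big_seq big1 ?addr0 // => a aA.
have [aS|/(supp0 aA) ->] := boolP (a \in supp A w); last by rewrite mul0r.
have [_] := e a aA; rewrite (fsubsetP wG a aS) => /eqP ->.
by rewrite subrr mulr0.
Qed.

(* An affine dependency would give two weightings of the same point; exposing
   the support of its positive part makes the height of the dependency negative,
   and by symmetry positive. *)
Lemma clique_affinely_independent G : clique G -> affinely_independent G.
Proof.
move=> cG w s0 v0; apply: contrapT => /existsNP[v /not_implyP[vG wv]].
have ltS (l : V -> R) : \sum_(v <- G) l v = 0 -> \sum_(v <- G) l v *: v = 0 ->
    (exists2 v, v \in G & l v != 0) -> \sum_(v <- G) l v * h v < 0.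
  move=> l0 lv0 [u uG lu].
  have [pu puG lpu] : exists2 v, v \in G & 0 < l v.
    apply: contrapT => /forall2NP nl.
    have lle0 a : a \in G -> 0 <= - l a.
      move=> aG; case: (nl a) => [/(_ aG)//|/negP].
      by rewrite -leNgt oppr_ge0.
    move/eqP: l0; rewrite -oppr_eq0 -sumrN big_seq psumr_eq0 //.
    by move=> /allP /(_ u uG); rewrite uG oppr_eq0 (negPf lu).
  pose G' := [fset a in G | 0 < l a].
  have G'G : (G' `<=` G)%fset by apply/fsubsetP => a; rewrite !inE => /andP[].
  have G'0 : G' != fset0.
    by apply/fset0Pn; exists pu; rewrite !inE puG.
  have [phi [t e]] := exposedA (clique_sub cG G'G) G'0.
  have -> : \sum_(v <- G) l v * h v = \sum_(v <- G) l v * (phi v + h v - t).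
    under [in RHS]eq_bigr do rewrite mulrBr mulrDr.
    rewrite big_split big_split /= sumrN -mulr_suml l0 mul0r.
    by rewrite -scalar_sum lv0 linear0; ring.
  have le0 a : a \in G -> l a * (phi a + h a - t) <= 0.
    move=> aG; have aA := fsubsetP cG.1 _ aG; have [te eG] := e a aA.
    have [la|la] := ltP 0 (l a); last by rewrite mulr_le0_ge0 // subr_ge0.
    by move: eG; rewrite !inE aG la => /eqP ->; rewrite subrr mulr0.
  have [nu nuG lnu] : exists2 v, v \in G & l v < 0.
    apply: contrapT => /forall2NP nl.
    have lge0 a : a \in G -> 0 <= l a.
      by move=> aG; case: (nl a) => [/(_ aG)//|/negP]; rewrite -leNgt.
    move/eqP: l0; rewrite big_seq psumr_eq0 //.
    by move=> /allP /(_ u uG); rewrite uG (negPf lu).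
  rewrite (big_fsetD1 nu) //=; apply: (@lt_le_trans _ _ (0 + 0)); last by rewrite addr0.
  apply: ltr_leD.
    rewrite nmulr_rlt0 // subr_gt0 lt_neqAle eq_sym.
    have [-> ->] := e nu (fsubsetP cG.1 _ nuG).
    by rewrite !inE nuG ltNge (ltW lnu).
  by rewrite big_seq; apply: sumr_le0 => a; rewrite !inE => /andP[_ /le0].
have lt0 : \sum_(v <- G) w v * h v < 0.
  by apply: ltS => //; exists v => //; apply/eqP.
have : \sum_(v <- G) - w v * h v < 0.
  apply: ltS; first by rewrite sumrN s0 oppr0.
    by under eq_bigr do rewrite scaleNr; rewrite sumrN v0 oppr0.
  by exists v => //; rewrite oppr_eq0; apply/eqP.
under eq_bigr do rewrite mulNr.
by rewrite sumrN oppr_lt0 ltNge ltW.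
Qed.

(** For a common point [x], the exposing functions of [G] and of [H] show that both weightings have
    minimal height among those of [x]. Their heights agree, so the weighting on [H] is also tight
    for [G], and its support lies in [G]. *)
Lemma hull_cliqueI G H : clique G -> clique H ->
  convex_hull [set` G] `&` convex_hull [set` H] =
  convex_hull [set` (G `&` H)%fset].
Proof.
move=> cG cH; have GHA : (G `&` H `<=` A)%fset.
  exact: fsubset_trans (fsubsetIl _ _) cG.1.
apply/seteqP; split=> x.
  move=> [Gx Hx].
  have [phi [t e]] := exposedA cG (hullN0 Gx).
  have [psi [s f]] := exposedA cH (hullN0 Hx).
  move: Gx => /(hull_represents _ cG.1)[w rw wG].
  move: Hx => /(hull_represents _ cH.1)[u ru uH].
  apply/(hull_represents _ GHA); exists u => //.
  rewrite fsubsetI uH andbT.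
  have [_ [_ /(_ wG) ew]] := exposes_height e rw.
  have [eu [euG _]] := exposes_height e ru.
  have [_ [_ /(_ uH) fu]] := exposes_height f ru.
  have [fw _] := exposes_height f rw.
  apply: euG; lra.
move=> /(hull_represents _ GHA)[w rw]; rewrite fsubsetI => /andP[wG wH].
by split; apply/hull_represents; rewrite ?cG.1 ?cH.1 //; exists w.
Qed.

Lemma hull_clique_vertex G a : clique G -> a \in A ->
  convex_hull [set` G] a -> a \in G.
Proof.
move=> cG aA Ga; have : (convex_hull [set` [fset a]] `&` convex_hull [set` G]) a.
  split=> //; apply/convex_hullP; exists (fun=> 1); rewrite ?big_seq_fset1 ?scale1r //.
  by split; rewrite ?big_seq_fset1.
rewrite hull_cliqueI //; last exact: clique1.
by move=> /hullN0 /fset0Pn[b]; rewrite !inE => /andP[/eqP ->].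
Qed.

(** Shifting weight from an incompatible pair [p], [q] to a cheaper pair with the same sum
    represents the same point at a smaller height. *)
Lemma minimal_weighting_clique x w : represents A w x ->
  (forall w', represents A w' x -> height A h w <= height A h w') ->
  clique (supp A w).
Proof.
move=> rw wmin; split; first exact: supp_sub.
move=> p q; rewrite !suppP => /andP[pA wp] /andP[qA wq] pq p' q' p'A q'A pqE.
rewrite leNgt; apply/negP => lt.
have w0 a : 0 <= w a by case: rw => -[].
pose t := Order.min (w p) (w q).
have t0 : 0 < t by rewrite lt_min !lt0r wp wq !w0.
pose l a : R := (a == p')%:R + (a == q')%:R - (a == p)%:R - (a == q)%:R.
have lE (W : lmodType R) (g : V -> W) :
    \sum_(a <- A) l a *: g a = g p' + g q' - g p - g q.
  under eq_bigr do rewrite !scalerDl !scaleNr.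
  by rewrite !big_split /= !sumrN !sum_fset_delta.
have [||| rw' hw'] := represents_shift h (l := l) (t := t) rw.
- move=> a aA; rewrite /l.
  have ta : t * ((a == p)%:R + (a == q)%:R) <= w a.
    have [->|ap] := eqVneq a p.
      by rewrite (negPf pq) addr0 mulr1 /t ge_min lexx.
    have [->|aq] := eqVneq a q; last by rewrite addr0 mulr0.
    by rewrite add0r mulr1 /t ge_min lexx orbT.
  have tb : 0 <= t * ((a == p')%:R + (a == q')%:R).
    by rewrite mulr_ge0 ?addr_ge0 // ltW.
  rewrite -addrA -opprD mulrBr; lra.
- transitivity (\sum_(a <- A) l a *: (1 : R^o)).
    by apply: eq_bigr => a _; rewrite [RHS]mulr1.
  by rewrite lE; ring.
- by rewrite (lE V id) -pqE -addrA -opprD subrr.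
have := wmin _ rw'; rewrite hw' lerDl (lE R^o h) pmulr_rge0 //.
move: lt; lra.
Qed.

Lemma cliques_cover x : P x -> exists2 G, clique G & convex_hull [set` G] x.
Proof.
rewrite hullA => /convex_hullP[w0 W0 x0].
have [w rw wmin] := minimal_weighting h (ex_intro _ w0 (conj W0 x0)).
exists (supp A w); first exact: minimal_weighting_clique wmin.
by apply/hull_represents; [exact: supp_sub | exists w].
Qed.

Lemma hull_sub G : (G `<=` A)%fset -> convex_hull [set` G] `<=` P.
Proof.
move=> GA x; rewrite hullA => -[n [v [w [vG w0 w1 ->]]]].
by exists n, v, w; split=> // i; apply: (fsubsetP GA); apply: vG.
Qed.

Lemma cliques_triangulation : triangulation L P clique.
Proof.
split.
- move=> G cG; split; last exact: clique_affinely_independent.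
  by rewrite latticeA => a /=; apply: (fsubsetP cG.1).
- by move=> G H; apply: clique_sub.
- exact: hull_cliqueI.
apply/seteqP; split=> x.
  by move=> [G cG]; apply: hull_sub; case: cG.
by move=> /cliques_cover[G cG Gx]; exists G.
Qed.

Lemma cliques_flag F : minimal_non_face L P clique F -> #|` F| = 2%N.
Proof.
move=> [FA nF sF].
have {}FA : (F `<=` A)%fset.
  by apply/fsubsetP => a aF; have := FA _ aF; rewrite latticeA.
(* [face] only compares convex hulls; since a point of [A] in the hull of a clique is one of its
   vertices, [H] is contained in [G]. *)
have faceP H : (H `<=` A)%fset -> face clique H -> clique H.
  move=> HA [G cG HG]; apply: (clique_sub cG).
  apply/fsubsetP => a aH; apply: hull_clique_vertex => //.
    exact: (fsubsetP HA).
  rewrite -HG; apply/convex_hullP; exists (fun b => (b == a)%:R).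
    split=> [b|]; first by [].
    transitivity (\sum_(b <- H) (b == a)%:R *: (1 : R^o)).
      by apply: eq_bigr => b _; rewrite [RHS]mulr1.
    exact: (@sum_fset_delta R V R^o H (fun=> 1)).
  by rewrite (@sum_fset_delta R V V H id).
have [p [q [pF qF pq npq]]] :
    exists p, exists q, [/\ p \in F, q \in F, p != q & ~ compatible p q].
  apply: contrapT => npq; apply: nF; exists F => //; split=> // p q pF qF pq.
  by apply: contrapT => nc; apply: npq; exists p, q.
have pqF : ([fset p; q] `<=` F)%fset.
  by apply/fsubsetP => a; rewrite !inE => /orP[] /eqP ->.
have : ~ ([fset p; q] `<` F)%fset.
  move=> pqF'; apply: npq.
  have [_] := faceP _ (fsubset_trans pqF FA) (sF _ pqF').
  by apply; rewrite // !inE eqxx ?orbT.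
move/negP; rewrite fproperEneq pqF andbT negbK => /eqP <-.
by rewrite cardfs2 pq.
Qed.

(** * Lower faces and regularity *)

Lemma lifted_polytopeP y : lifted_polytope L P h y <->
  exists2 w, weighting A w & y = (\sum_(a <- A) w a *: a, height A h w).
Proof.
have E w : \sum_(a <- A) w a *: ((a, h a) : (V * R^o)%type) =
    (\sum_(a <- A) w a *: a, height A h w).
  rewrite /height; elim/big_rec3: _ => // a x1 x2 x3 _ ->.
  by [].
rewrite /lifted_polytope latticeA.
rewrite (@convex_hull_image R V (V * R^o)%type A (fun a => (a, h a))).
by split=> -[w W ->]; exists w; rewrite ?E.
Qed.

Lemma exposed_lower_face phi t G : exposes phi t G -> (G `<=` A)%fset ->
  G != fset0 ->
  [set x.1 | x in [set x | lifted_polytope L P h x /\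
    forall y, lifted_polytope L P h y -> phi x.1 + x.2 <= phi y.1 + y.2]] =
  convex_hull [set` G].
Proof.
move=> e GA /fset0Pn[g gG]; have gA := fsubsetP GA _ gG.
apply/seteqP; split=> x.
  move=> [_ [/lifted_polytopeP[w W ->] /= xmin] <-].
  have rw : represents A w (\sum_(a <- A) w a *: a) by [].
  have [_ [weq _]] := exposes_height e rw.
  apply/(hull_represents _ GA); exists w => //; apply: weq; apply: le_anti.
  rewrite (exposes_height e rw).1 andbT.
  have [_] := e g gA; rewrite gG => /eqP <-.
  have [d D gd] : exists2 w, weighting A w &
      ((g, h g) : (V * R^o)%type) = (\sum_(a <- A) w a *: a, height A h w).
    exists (fun a => (a == g)%:R).
      split=> //; transitivity (\sum_(b <- A) (b == g)%:R *: (1 : R^o)).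
        by apply: eq_bigr => b _; rewrite [RHS]mulr1.
      exact: (@sum_fset_delta R V R^o A (fun=> 1)).
    rewrite (@sum_fset_delta R V V A id) //; congr (_, _).
    exact/esym/(@sum_fset_delta R V R^o A h).
  have /xmin : lifted_polytope L P h (g, h g).
    by apply/lifted_polytopeP; exists d.
  by [].
move=> /(hull_represents _ GA)[w rw wG].
have [W xw] := rw; exists (x, height A h w) => //; split.
  by apply/lifted_polytopeP; exists w; rewrite // xw.
move=> y /lifted_polytopeP[u U ->] /=.
have ru : represents A u (\sum_(a <- A) u a *: a) by [].
have [_ [_ ->]] := exposes_height e rw; last exact: wG.
by have [] := exposes_height e ru.
Qed.

(** Exposed cliques are projections of lower faces. Conversely, the minimizers of [phi + h] on [A]
    form a clique: pairs with equal sum have equal total [phi], so minimality compares their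
    heights. *)
Lemma cliques_regular : regular L P clique.
Proof.
exists h => X X0; split=> [[G cG XG]|[Q [phi QE] XQ]].
  have G0 : G != fset0 by case: X0 => x; rewrite XG => /hullN0.
  have [phi [t e]] := exposedA cG G0.
  rewrite XG -(exposed_lower_face e cG.1 G0).
  by eexists; first by exists phi; reflexivity.
have [x [[q1 q2] Qq _]] : exists x, [set x.1 | x in Q] x.
  by rewrite -XQ.
have {q1 q2 Qq x} [a0 a0A] : exists a, a \in A.
  move: Qq; rewrite QE => -[/lifted_polytopeP[w [_ w1] _] _].
  apply/fset0Pn/eqP => A0; move: w1.
  by rewrite A0 big_seq_fset0 => /esym/eqP; rewrite oner_eq0.
have [g gA gmin] := exists_argmin (fun a => phi a + h a) a0A.
pose t := phi g + h g; pose G := [fset a in A | phi a + h a == t].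
have GA : (G `<=` A)%fset by apply/fsubsetP => a; rewrite !inE => /andP[].
have e : exposes phi t G.
  by move=> a aA; rewrite !inE aA; split=> //; apply: gmin.
have G0 : G != fset0 by apply/fset0Pn; exists g; rewrite !inE gA /= eqxx.
exists G; last by rewrite -(exposed_lower_face e GA G0) -QE.
split=> // p q; rewrite !inE => /andP[pA /eqP pt] /andP[qA /eqP qt] _.
move=> p' q' p'A q'A pq.
have : phi p + phi q = phi p' + phi q' by rewrite -!linearD pq.
have := gmin _ p'A; have := gmin _ q'A; rewrite -/t; lra.
Qed.

(** * Maximal cliques and unimodularity *)

Lemma hull_segment x z (e : R) : P x -> P z -> 0 <= e <= 1 ->
  P ((1 - e) *: x + e *: z).
Proof.
rewrite hullA => /convex_hullP[u [u0 u1] ->] /convex_hullP[v [v0 v1] ->].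
move=> /andP[e0 e1]; apply/convex_hullP.
exists (fun a => (1 - e) * u a + e * v a).
  split=> [a|]; first by rewrite addr_ge0 // mulr_ge0 // subr_ge0.
  by rewrite big_split /= -!mulr_sumr u1 v1; ring.
rewrite !scaler_sumr -big_split /=; apply: eq_bigr => a _.
by rewrite [RHS]scalerDl !scalerA.
Qed.

(* Near the barycenter [x] of [G] only cliques containing [G] occur: for a clique
   [H] that does not contain [G], the difference [D] of the affine functions
   exposing [H] and [G] is nonnegative on [H] but negative at [x]. *)
Lemma maximal_clique_spans G : clique G ->
  (forall H, clique H -> (G `<=` H)%fset -> H = G) ->
  P `<=` affine_span [set` G].
Proof.
move=> cG Gmax z Pz.
have G0 : G != fset0.
  have [H cH /hullN0 H0] := cliques_cover Pz.
  by apply: contraNneq H0 => G0; rewrite (Gmax H) ?G0 ?fsub0set.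
have n0 : 0 < (#|` G|%:R : R) by rewrite ltr0n cardfs_gt0.
pose u a : R := if a \in G then #|` G|%:R^-1 else 0.
have u0 a : a \in A -> a \notin G -> u a = 0 by rewrite /u => _ /negPf ->.
pose x := \sum_(a <- A) u a *: a.
have ru : represents A u x.
  split=> //; split=> [a|].
    by rewrite /u; case: ifP => // _; rewrite invr_ge0 ltW.
  rewrite (sum_fset_restrict1 cG.1 u0).
  rewrite big_seq (eq_bigr (fun=> #|` G|%:R^-1)); last by move=> a; rewrite /u => ->.
  rewrite -big_seq big_const_seq count_predT iter_addr_0.
  by rewrite -[LHS]mulr_natr mulVf // gt_eqF.
have uG : (supp A u `<=` G)%fset.
  apply/fsubsetP => a; rewrite suppP => /andP[aA].
  by apply: contraNT => /(u0 _ aA) ->.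
have Px : P x by apply: (hull_sub cG.1); apply/(hull_represents _ cG.1); exists u.
have [phi [t eG]] := exposedA cG G0.
have [_ [_ /(_ uG) xt]] := exposes_height eG ru.
pose y e : V := (1 - e) *: x + e *: z.
have near H : exists2 e, 0 < e & forall e', 0 < e' <= e -> clique H ->
    ~~ (G `<=` H)%fset -> ~ convex_hull [set` H] (y e').
  have [[cH GH]|nH] := pselect (clique H /\ ~~ (G `<=` H)%fset); last first.
    by exists 1 => // e' _ cH GH; case: nH.
  have [H0|H0] := eqVneq H fset0.
    by exists 1 => // e' _ _ _ /hullN0; rewrite H0 eqxx.
  have [psi [s eH]] := exposedA cH H0.
  pose D a := s - t + phi a - psi a.
  have Dx : D x < 0.
    have [le [eq _]] := exposes_height eH ru.
    suff : s != psi x + height A h u.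
      by move=> ne; have := lt_neqAle s (psi x + height A h u);
        rewrite ne le /D => lt; move: xt lt; lra.
    apply: contra GH => /eqP/esym/eq uH; apply/fsubsetP => a aG.
    apply: (fsubsetP uH); rewrite suppP (fsubsetP cG.1 _ aG) /u aG.
    by rewrite invr_eq0 gt_eqF.
  have D0 a : convex_hull [set` H] a -> 0 <= D a.
    move=> /(hull_represents _ cH.1)[w rw wH].
    have [_ [_ /(_ wH) ws]] := exposes_height eH rw.
    have [wt _] := exposes_height eG rw.
    rewrite /D; lra.
  (* Along the segment from [x] to [z], [D] stays negative as long as [e' * (D z - D x) < - D x];
     [K] is a positive number exceeding [D z - D x]. *)
  pose K := `|D z| - D x + 1.
  have Kge : 1 + D z - D x <= K by rewrite /K; have := ler_norm (D z); lra.
  have K0 : 0 < K by rewrite /K; have := normr_ge0 (D z); lra.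
  exists (- D x / K); first by rewrite divr_gt0 ?oppr_gt0.
  move=> e' /andP[e'0]; rewrite ler_pdivlMr // => e'K _ _ /D0.
  have -> : D (y e') = (1 - e') * D x + e' * D z.
    by rewrite /D /y !linearD !linearZ /=; ring.
  apply/negP; rewrite -ltNge; nra.
(* There are finitely many cliques, so one [e] serves for all of them. *)
have fin (s : seq {fset V}) : exists2 e, 0 < e <= 1 & forall H, H \in s ->
    forall e', 0 < e' <= e -> clique H -> ~~ (G `<=` H)%fset ->
    ~ convex_hull [set` H] (y e').
  elim: s => [|H s [e /andP[e0 e1] ye]]; first by exists 1; rewrite ?ltr01 ?lexx.
  have [d d0 yd] := near H.
  exists (Order.min d e); first by rewrite lt_min d0 e0 ge_min e1 orbT.
  move=> H'; rewrite inE => /predU1P[->|H's] e' /andP[e'0].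
    by rewrite le_min => /andP[e'd _]; apply: yd; rewrite e'0.
  by rewrite le_min => /andP[_ e'e]; apply: ye; rewrite ?e'0.
have [e e01 ye] := fin (fpowerset A).
have /andP[e0 e1] := e01.
have e01' : 0 <= e <= 1 by rewrite (ltW e0).
have [H cH Hy] := cliques_cover (hull_segment Px Pz e01').
have HG : H = G.
  apply: Gmax => //; apply: contrapT => /negP GH.
  apply: (ye H _ e) GH Hy; rewrite ?lexx ?e0 //.
  by rewrite fpowersetE; case: cH.
move: Hy; rewrite HG => /convex_hullP[w [_ w1] yw].
(* Solves [y e = (1 - e) *: x + e *: z] for [z], with [x] and [y e] combinations of [G]. *)
apply/affine_spanP; exists (fun a => e^-1 * (w a - (1 - e) * u a)).
  rewrite -mulr_sumr sumrB w1 -mulr_sumr -(sum_fset_restrict1 cG.1 u0).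
  by rewrite ru.1.2; field; rewrite gt_eqF.
under eq_bigr do rewrite -scalerA scalerBl -scalerA.
rewrite -scaler_sumr sumrB -scaler_sumr -(sum_fset_restrict _ cG.1 u0).
rewrite -yw -/x addrAC subrr add0r scalerA mulVf ?scale1r //.
by rewrite gt_eqF.
Qed.

Lemma affine_span_trans (G : {fset V}) (X : set V) :
  X `<=` affine_span [set` G] -> affine_span X `<=` affine_span [set` G].
Proof.
move=> XG x [n [v [u [Xv u1 ->]]]].
have /choice[f fP] i : exists w,
    \sum_(g <- G) w g = 1 /\ v i = \sum_(g <- G) w g *: g.
  by have /affine_spanP[w w1 vw] := XG _ (Xv i); exists w.
apply/affine_spanP; exists (fun g => \sum_i u i * f i g).
  rewrite exchange_big /= -[RHS]u1; apply: eq_bigr => i _.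
  by rewrite -mulr_sumr (fP i).1 mulr1.
under [RHS]eq_bigr do rewrite scaler_suml.
rewrite exchange_big /=; apply: eq_bigr => i _.
rewrite (fP i).2 scaler_sumr; apply: eq_bigr => g _.
by rewrite scalerA.
Qed.

(** A maximal clique affinely spans the polytope, and by [integralA] every lattice point of the span
    is an integral affine combination of it. Hence the edge vectors at its first vertex form a
    lattice basis, in which their coordinate matrix is the identity. *)
Lemma cliques_unimodular : unimodular L P clique.
Proof.
move=> G cG Gmax; have PG := maximal_clique_spans cG Gmax.
have AP a : a \in A -> P a /\ L a.
  by move=> aA; have : [set` A] a by []; rewrite -latticeA => -[].
have [g0 g0G] : exists g, g \in G.
  apply/fset0Pn; case/fset0Pn: A_neq0 => a aA; apply/eqP => G0.
  have := Gmax _ (clique1 aA); rewrite G0 fsub0set => /(_ isT) /fsetP /(_ a).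
  by rewrite !inE eqxx.
have [n nG] : exists n, #|` G| = n.+1.
  by exists #|` G|.-1; rewrite prednK // cardfs_gt0; apply/fset0Pn; exists g0.
pose v (i : 'I_n.+1) := nth 0 G i.
have vG i : v i \in G by rewrite mem_nth // nG.
have vinj : injective v.
  by move=> i j /eqP; rewrite nth_uniq ?nG ?fset_uniq // => /eqP/val_inj.
have sumG (W : nmodType) (f : V -> W) :
    \sum_(g <- G) f g = \sum_(i < n.+1) f (v i).
  by rewrite (big_nth 0) nG big_mkord.
pose b j := v (lift ord0 j) - v ord0.
have bE (e : 'I_n.+1 -> R) : \sum_i e i = 0 ->
    \sum_i e i *: v i = \sum_j e (lift ord0 j) *: b j.
  rewrite !big_ord_recl => /eqP; rewrite addr_eq0 => /eqP ->.
  under [RHS]eq_bigr do rewrite scalerBr.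
  by rewrite sumrB -scaler_suml scaleNr addrC.
have spanP x : (affine_span P `&` L) x -> exists2 w : V -> R,
    \sum_(g <- G) w g = 1 & (forall g, g \in G -> w g \is a Num.int) /\
    x = \sum_(g <- G) w g *: g.
  move=> [/(affine_span_trans PG)/affine_spanP[w w1 xw] Lx].
  by exists w => //; split=> //; apply: (integralA cG) => //; rewrite -xw.
have subP a : P a -> affine_span P a.
  move=> Pa; exists 1%N, (fun=> a), (fun=> 1).
  by rewrite !big_ord1 scale1r.
exists n, b, v, 1%:M; split.
- split=> [j|_ [x /spanP[w w1 [wi ->]] [y /spanP[u u1 [ui ->]] <-]]].
    have [p1 l1] := AP _ (fsubsetP cG.1 _ (vG (lift ord0 j))).
    have [p2 l2] := AP _ (fsubsetP cG.1 _ (vG ord0)).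
    exists (v (lift ord0 j)); first by split=> //; apply: subP.
    by exists (v ord0) => //; split=> //; apply: subP.
  pose d i := w (v i) - u (v i).
  have di i : d i \is a Num.int by rewrite rpredB ?wi ?ui.
  have -> : \sum_(g <- G) w g *: g - \sum_(g <- G) u g *: g =
      \sum_j d (lift ord0 j) *: b j.
    rewrite -bE; last by rewrite /d sumrB -!sumG w1 u1 subrr.
    rewrite -sumrB (sumG _ (fun g => w g *: g - u g *: g)).
    by apply: eq_bigr => i _; rewrite scalerBl.
  exists (\row_j Num.floor (d (lift ord0 j))); split.
    by apply: eq_bigr => j _; rewrite mxE floorK.
  move=> z zE; apply/rowP => j; rewrite mxE.
  (* Two coordinate vectors of the same point differ by [f]; completing it at index 0 to total 0
     gives an affine dependency [e] of the clique. *)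
  pose f j := d (lift ord0 j) - (z 0 j)%:~R.
  pose e (i : 'I_n.+1) := if unlift ord0 i is Some j then f j else - \sum_j f j.
  have el k : e (lift ord0 k) = f k by rewrite /e liftK.
  have e0 : \sum_i e i = 0.
    rewrite big_ord_recl; under eq_bigr do rewrite el.
    by rewrite /e unlift_none addNr.
  have ev0 : \sum_i e i *: v i = 0.
    rewrite bE //; under eq_bigr do rewrite el /f scalerBl.
    by rewrite sumrB zE subrr.
  have := clique_affinely_independent cG.
  move=> /(_ (fun a => \sum_i e i * (a == v i)%:R)).
  rewrite sum_fset_collect1 // (@sum_fset_collect R V V G id) //.
  move=> /(_ e0 ev0 _ (vG (lift ord0 j))).
  rewrite (bigD1 (lift ord0 j)) //= eqxx mulr1 big1 => [|i].
    rewrite addr0 el => /eqP; rewrite subr_eq0 => /eqP ->.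
    by rewrite intrKfloor.
  by rewrite eq_sym (inj_eq vinj) => /negPf ->; rewrite mulr0.
- apply/seteqP; split=> x /=; last by move=> [i _ <-].
  move=> xG; have xn : (index x G < n.+1)%N by rewrite -nG index_mem.
  by exists (Ordinal xn) => //; rewrite /v /= nth_index.
- move=> i; rewrite (bigD1 i) //= big1 => [|j ji].
    by rewrite addr0 mxE eqxx scale1r.
  by rewrite mxE eq_sym (negPf ji) scale0r.
- by rewrite det1 normr1.
Qed.

Lemma quadratic_triangulation_cliques : quadratic_triangulation L P clique.
Proof.
split; [exact: cliques_triangulation | exact: cliques_regular |
        exact: cliques_unimodular | exact: cliques_flag].
Qed.

End QuadraticCriterion.

(** * Cycles in K_{3,3} and integral hulls *)

Lemma ord3_cases (a b c d : 'I_3) : a != b -> a != c -> b != c ->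
  [\/ d = a, d = b | d = c].
Proof.
move=> ab ac bc; have [->|da] := eqVneq d a; first exact: Or31.
have [->|db] := eqVneq d b; first exact: Or32.
have [->|dc] := eqVneq d c; first exact: Or33.
have := max_card (mem [:: a; b; c; d]).
by rewrite card_ord (card_uniqP _) //= !inE !negb_or ab ac bc !(eq_sym _ d) da db dc.
Qed.

(* [S] is the edge set of a subgraph of K_{3,3} without leaves; the matrix
   [d] is the alternating sign vector of a cycle of this graph. *)
Lemma leafless_cycle (S : 'I_3 -> 'I_3 -> bool) i0 j0 : S i0 j0 ->
  (forall i j, S i j -> exists2 k, k != j & S i k) ->
  (forall i j, S i j -> exists2 k, k != i & S k j) ->
  exists d : 'I_3 -> 'I_3 -> int,
    [/\ forall i j, d i j != 0 -> S i j, forall i j, `|d i j| <= 1,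
        forall i, \sum_j d i j = 0, forall j, \sum_i d i j = 0
      & exists i j, d i j != 0].
Proof.
move=> S00 Srow Scol.
pose e (i k a : 'I_3) : int := (a == i)%:R - (a == k)%:R.
have e0 i k : \sum_a e i k a = 0.
  have s1 l : \sum_a ((a == l)%:R : int) = 1 :> int.
    by rewrite (bigD1 l) //= eqxx big1 ?addr0 // => b /negPf ->.
  by rewrite sumrB !s1 subrr.
have eN i k a : e i k a != 0 -> a = i \/ a = k.
  by rewrite /e; have [|_] := eqVneq a i; [left | have [|_] := eqVneq a k; [right|]].
(* A 4-cycle is the product of two difference vectors. *)
have four i k j l : i != k -> j != l -> S i j -> S i l -> S k j -> S k l ->
    exists d : 'I_3 -> 'I_3 -> int,
    [/\ forall i j, d i j != 0 -> S i j, forall i j, `|d i j| <= 1,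
        forall i, \sum_j d i j = 0, forall j, \sum_i d i j = 0
      & exists i j, d i j != 0].
  move=> ik jl Sij Sil Skj Skl; exists (fun a b => e i k a * e j l b); split.
  - by move=> a b; rewrite mulf_eq0 negb_or => /andP[/eN[] -> /eN[] ->].
  - by move=> a b; rewrite /e; do 4![case: eqP => _].
  - by move=> a; rewrite -mulr_sumr e0 mulr0.
  - by move=> b; rewrite -mulr_suml e0 mul0r.
  - by exists i, j; rewrite /e !eqxx (negPf ik) (negPf jl).
have [j1 j10 S01] := Srow _ _ S00.
have [i1 i10 S10] := Scol _ _ S00.
have [i2 i20 S21] := Scol _ _ S01.
have [S11|nS11] := boolP (S i1 j1).
  by apply: (four i0 i1 j0 j1); rewrite // eq_sym.
have [S20|nS20] := boolP (S i2 j0).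
  by apply: (four i0 i2 j0 j1); rewrite // eq_sym.
have i12 : i1 != i2 by apply: contraNneq nS11 => ->.
have [k k0 S1k] := Srow _ _ S10.
have k1 : k != j1 by apply: contraNneq nS11 => <-.
have [l l1 S2l] := Srow _ _ S21.
rewrite eq_sym in i10; rewrite eq_sym in i20; rewrite eq_sym in j10.
rewrite eq_sym in k0; rewrite eq_sym in k1.
(* Without a 4-cycle, the second edges at [i1] and [i2] both end in the third column. *)
have lk : l = k.
  have [l0|lj|//] := ord3_cases l j10 k0 k1; last by rewrite lj eqxx in l1.
  by rewrite -l0 S2l in nS20.
rewrite {l}lk in l1 S2l.
(* The 6-cycle is the sum of two 4-cycles that cancel at their common edge [(i0, k)]. *)
exists (fun a b => e i0 i1 a * e j0 k b + e i0 i2 a * e k j1 b).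
have nE (x y : 'I_3) : x != y -> ((x == y) = false) * ((y == x) = false).
  by move=> /negPf xy; split; rewrite // eq_sym.
have neq := (nE _ _ i10, nE _ _ i20, nE _ _ i12, nE _ _ j10, nE _ _ k0, nE _ _ k1).
have E i j : [\/ i = i0, i = i1 | i = i2] /\ [\/ j = j0, j = j1 | j = k].
  by split; apply: ord3_cases.
split.
- move=> a b; case: (E a b) => -[->|->|->] [->|->|->] //;
  by rewrite /e ?eqxx ?neq.
- move=> a b; case: (E a b) => -[->|->|->] [->|->|->];
  by rewrite /e ?eqxx ?neq.
- by move=> a; rewrite big_split /= -!mulr_sumr !e0 !mulr0.
- by move=> b; rewrite big_split /= -!mulr_suml !e0 !mul0r.
- by exists i0, j0; rewrite /e ?eqxx ?neq.
Qed.

Lemma convex_hull_segment (R : realType) (V : lmodType R) (X : set V) a b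
    (s t : R) : convex_hull X a -> convex_hull X b ->
  0 <= s -> 0 <= t -> s + t = 1 -> convex_hull X (s *: a + t *: b).
Proof.
move=> [n [v [w [Xv w0 w1 ->]]]] [m [v' [w' [Xv' w'0 w'1 ->]]]] s0 t0 st.
exists (n + m)%N, (fun i => match fintype.split i with inl j => v j | inr j => v' j end),
  (fun i => match fintype.split i with inl j => s * w j | inr j => t * w' j end).
have El (j : 'I_n) : fintype.split (lshift m j) = inl j by exact: (unsplitK (inl j)).
have Er (j : 'I_m) : fintype.split (rshift n j) = inr j by exact: (unsplitK (inr j)).
split=> [i|i||].
- by case: fintype.split.
- by case: fintype.split => j; rewrite mulr_ge0.
- rewrite big_split_ord /=; under eq_bigr do rewrite El.
  under [X in _ + X]eq_bigr do rewrite Er.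
  by rewrite -!mulr_sumr w1 w'1 !mulr1.
rewrite big_split_ord /=; under [X in _ = X + _]eq_bigr do rewrite El -scalerA.
under [X in _ = _ + X]eq_bigr do rewrite Er -scalerA.
by rewrite -!scaler_sumr.
Qed.

(** Supplies the absence of leaves for [leafless_cycle]: in a line with integral sum, a fractional
    entry is never alone. *)
Lemma sum_not_int (R : realType) n (z : 'I_n -> R) k : \sum_j z j \is a Num.int ->
  z k \isn't a Num.int -> exists2 j, j != k & z j \isn't a Num.int.
Proof.
move=> sZ zk; apply: contrapT => /forall2NP nz; case/negP: zk.
move: sZ; rewrite (bigD1 k) //= rpredDr // rpred_sum // => j jk.
by case: (nz j) => [/(_ jk)//|/negP]; rewrite negbK.
Qed.

(** * Integrality of transportation polytopes with bounded entries *)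

Section IntegralBox.
Variables (R : realType) (l u : 'I_3 -> 'I_3 -> int) (rho kappa : 'I_3 -> int).
Implicit Types x y : 'M[R]_3.

Definition box x := [/\ forall i j, (l i j)%:~R <= x i j <= (u i j)%:~R,
  forall i, \sum_j x i j = (rho i)%:~R & forall j, \sum_i x i j = (kappa j)%:~R].

Definition fractional x := [set p : 'I_3 * 'I_3 | x p.1 p.2 \isn't a Num.int]%SET.

Lemma box_move x (d : 'I_3 -> 'I_3 -> int) : box x ->
  (forall i j, d i j != 0 -> (i, j) \in fractional x) ->
  (forall i j, `|d i j| <= 1) ->
  (forall i, \sum_j d i j = 0) -> (forall j, \sum_i d i j = 0) ->
  (exists i j, d i j != 0) ->
  exists t, let x' := x + t *: \matrix_(i, j) (d i j)%:~R in
    [/\ 0 < t, box x' & (#|fractional x'| < #|fractional x|)%N].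
Proof.
move=> [xb xr xc] dS d1 dr dc [i0 [j0 d00]].
pose f (p : 'I_3 * 'I_3) : R := (Num.floor (x p.1 p.2))%:~R.
(* [g p] is the distance from the entry at [p] to the next integer in the direction of [d]. The
   least such distance makes an entry integral while none leaves its unit interval, so the integral
   bounds survive. *)
pose g p := if 0 < d p.1 p.2 then f p + 1 - x p.1 p.2 else x p.1 p.2 - f p.
have fx p : d p.1 p.2 != 0 -> f p < x p.1 p.2 < f p + 1.
  move=> dp; have := dS p.1 p.2 dp; rewrite inE /= => xZ.
  rewrite lt_neqAle Num.Theory.floor_le andbT.
  have := floorD1_gt (x p.1 p.2); rewrite intrD => ->; rewrite andbT.
  by apply: contraNneq xZ => <-; rewrite intr_int.
have g0 p : d p.1 p.2 != 0 -> 0 < g p.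
  by move=> /fx/andP[fl fr]; rewrite /g; case: ifP => _; rewrite subr_gt0.
pose s := [seq p <- enum {: 'I_3 * 'I_3} | d p.1 p.2 != 0].
have s00 : (i0, j0) \in s by rewrite mem_filter d00 mem_enum.
have [p ps pmin] := exists_argmin g s00.
have dp : d p.1 p.2 != 0 by move: ps; rewrite mem_filter => /andP[].
pose t := g p; have t0 : 0 < t by exact: g0.
have dE q : d q.1 q.2 != 0 -> (d q.1 q.2 = 1) \/ (d q.1 q.2 = -1).
  by have := d1 q.1 q.2; lia.
have tg q : d q.1 q.2 != 0 -> t <= g q.
  by move=> dq; apply: pmin; rewrite mem_filter dq mem_enum.
exists t => x'.
have x'E i j : x' i j = x i j + t * (d i j)%:~R by rewrite !mxE.
have x'0 i j : d i j = 0 -> x' i j = x i j by rewrite x'E => ->; rewrite mulr0 addr0.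
have x'f q : d q.1 q.2 != 0 -> f q <= x' q.1 q.2 <= f q + 1.
  move=> dq; have /andP[fl fr] := fx q dq; have := tg q dq.
  rewrite x'E /g; case: (dE q dq) => ->.
    by rewrite ltr01 mulr1; lra.
  by rewrite ltr0N1 mulrN1z mulrN mulr1; lra.
split=> //.
  split=> [i j|i|j].
  - have [dij|dij] := eqVneq (d i j) 0; first by rewrite x'0.
    have /andP[xl xu] := xb i j.
    have /andP[fl fr] := fx (i, j) dij.
    have /andP[] := x'f (i, j) dij; rewrite /f /= => f1 f2.
    have lf : (l i j)%:~R <= f (i, j) by rewrite ler_int floor_ge_int.
    have fu : f (i, j) + 1 <= (u i j)%:~R.
      rewrite /f -[1]/(1%:~R) -intrD ler_int lezD1 floor_lt_int /= lt_neqAle xu andbT.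
      by have := dS i j dij; rewrite inE /=; apply: contraNneq => ->; rewrite intr_int.
    by rewrite (le_trans lf) //= (le_trans _ fu).
  - under eq_bigr do rewrite x'E.
    by rewrite big_split /= xr -mulr_sumr -rmorph_sum dr mulr0 addr0.
  - under eq_bigr do rewrite x'E.
    by rewrite big_split /= xc -mulr_sumr -rmorph_sum dc mulr0 addr0.
apply: proper_card; apply/properP; split.
  apply/fintype.subsetP => -[i j]; rewrite inE /= => x'Z.
  have [dij|] := eqVneq (d i j) 0; last exact: dS.
  by rewrite inE /= -(x'0 _ _ dij).
exists p; first by have := dS p.1 p.2 dp; rewrite -surjective_pairing.
rewrite inE negbK x'E /t /g; case: (dE p dp) => ->.
  by rewrite ltr01 mulr1 addrC subrK rpredD ?rpred1 // /f; apply: intr_int.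
by rewrite ltr0N1 mulrN1z mulrN mulr1 opprB addrC subrK /f; apply: intr_int.
Qed.

(** Induction on the number of fractional entries: they contain a cycle, and moving along it both
    ways puts [x] between two points of the box with fewer fractional entries. *)
Lemma box_hull x : box x ->
  convex_hull [set y | box y /\ forall i j, y i j \is a Num.int] x.
Proof.
have [n] := ubnP #|fractional x|; elim: n x => // n IH x xn bx.
have [bl xr xc] := bx.
have [x0|[[i0 j0] xij]] := set_0Vmem (fractional x).
  exists 1%N, (fun=> x), (fun=> 1); rewrite !big_ord1 scale1r.
  split=> // _; split=> // i j; apply: contrapT => /negP nZ.
  have : (i, j) \in fractional x by rewrite inE.
  by rewrite x0 inE.
have [d [dS d1 dr dc d0]] : exists d : 'I_3 -> 'I_3 -> int,
    [/\ forall i j, d i j != 0 -> (i, j) \in fractional x, forall i j, `|d i j| <= 1,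
        forall i, \sum_j d i j = 0, forall j, \sum_i d i j = 0
      & exists i j, d i j != 0].
  apply: (@leafless_cycle (fun i j => (i, j) \in fractional x) i0 j0) => //.
    move=> i j; rewrite inE /= => xZ.
    have [|k kj kZ] := @sum_not_int _ _ (x i) j _ xZ; first by rewrite xr intr_int.
    by exists k; rewrite // inE.
  move=> i j; rewrite inE /= => xZ.
  have [|k kj kZ] := @sum_not_int _ _ (x^~ j) i _ xZ; first by rewrite xc intr_int.
  by exists k; rewrite // inE.
have [t [t0 bt ft]] := box_move bx dS d1 dr dc d0.
have [|||||s [s0 bs fs]] := @box_move x (fun i j => - d i j) bx.
- by move=> i j; rewrite oppr_eq0; apply: dS.
- by move=> i j; rewrite normrN.
- by move=> i; rewrite sumrN dr oppr0.
- by move=> i; rewrite sumrN dc oppr0.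
- by case: d0 => i [j dij]; exists i, j; rewrite oppr_eq0.
have ht := IH _ (leq_trans ft xn) bt.
have hs := IH _ (leq_trans fs xn) bs.
have ts0 : 0 < t + s by rewrite addr_gt0.
have := convex_hull_segment (s := s / (t + s)) (t := t / (t + s)) ht hs.
rewrite !divr_ge0 ?(ltW ts0) ?(ltW t0) ?(ltW s0) // -mulrDl addrC divff ?gt_eqF //.
move=> /(_ isT isT erefl); congr (convex_hull _ _).
apply/matrixP => i j; rewrite !mxE rmorphN /=; field.
by rewrite gt_eqF.
Qed.

End IntegralBox.

(** * Unit triangles and cells *)

Local Notation o0 := (@Ordinal 3 0 isT).
Local Notation o1 := (@Ordinal 3 1 isT).
Local Notation o2 := (@Ordinal 3 2 isT).

Lemma ord3P (P : 'I_3 -> Prop) : P o0 -> P o1 -> P o2 -> forall i, P i.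
Proof.
move=> P0 P1 P2 [[|[|[|//]]] i3].
- by rewrite (_ : Ordinal i3 = o0) //; apply: val_inj.
- by rewrite (_ : Ordinal i3 = o1) //; apply: val_inj.
- by rewrite (_ : Ordinal i3 = o2) //; apply: val_inj.
Qed.

Lemma sum_ord3 (V : nmodType) (f : 'I_3 -> V) :
  \sum_i f i = f o0 + f o1 + f o2.
Proof.
rewrite !big_ord_recl big_ord0 addr0 addrA.
by congr (f _ + f _ + f _); apply: val_inj.
Qed.

Definition sg (e : bool) : int := if e then 1 else -1.

(** With [m] the coordinatewise minimum over [Q], the members are [m] plus 0/1 vectors with [k]
    ones. The minimum is attained at coordinate 0, so [k <= 2]: a point, an upward triangle, or a
    downward triangle around [m + (1, 1, 1)]. *)
Lemma alcove (Q : set ('I_3 -> int)) (s : int) : Q !=set0 -> 0 < s ->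
  (forall v, Q v -> forall j, 0 <= v j) -> (forall v, Q v -> \sum_j v j = s) ->
  (forall v w, Q v -> Q w -> forall j, v j - w j <= 1) ->
  exists m e, [/\ forall i j, 0 <= m j + sg e * (j == i)%:R,
    \sum_j m j + sg e = s &
    forall v, Q v -> exists i, forall j, v j = m j + sg e * (j == i)%:R].
Proof.
move=> [v0 Qv0] s0 Q0 Qs Q1.
have /choice[m mP] j : exists k, (forall v, Q v -> k <= v j <= k + 1) /\
    (exists2 v, Q v & v j = k).
  have [[v Qv lt]|/forall2NP nlt] := pselect (exists2 v, Q v & v j < v0 j).
    exists (v j); split; last by exists v.
    move=> w Qw; have := Q1 _ _ Qw Qv j; have := Q1 _ _ Qv0 Qw j; lia.
  exists (v0 j); split; last by exists v0.
  move=> w Qw; have := Q1 _ _ Qw Qv0 j; case: (nlt w) => // /negP; lia.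
have mb v j : Q v -> m j <= v j <= m j + 1 by case: (mP j) => + _; apply.
have m0 j : 0 <= m j by case: (mP j) => _ [v /Q0 + <-].
have sm v : Q v -> v o0 + v o1 + v o2 = s by move=> /Qs; rewrite sum_ord3.
have [k [km k0 k2]] : exists k : int, [/\ s = m o0 + m o1 + m o2 + k, 0 <= k & k <= 2].
  exists (s - m o0 - m o1 - m o2); split; first by lia.
    by have := mb _ o0 Qv0; have := mb _ o1 Qv0; have := mb _ o2 Qv0;
      have := sm _ Qv0; lia.
  have [_ [v Qv vm]] := mP o0.
  by have := mb _ o0 Qv; have := mb _ o1 Qv; have := mb _ o2 Qv;
    have := sm _ Qv; lia.
have [kk|[kk|kk]] : k = 0 \/ k = 1 \/ k = 2 by move: k0 k2; lia.
(* Here [m] is the only point; since [s > 0] it has a positive coordinate, and [m - e_i] is the base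
   of an upward triangle with nonnegative corners. *)
- have [i mi] : exists i, 1 <= m i.
    have [c|[c|c]] : 1 <= m o0 \/ 1 <= m o1 \/ 1 <= m o2 by lia.
    - by exists o0.
    - by exists o1.
    - by exists o2.
  exists (fun j => m j - (j == i)%:R), true; split.
  - move=> a j; have := m0 j; case: eqP => [->|_]; case: eqP => _ /=; lia.
  - rewrite sum_ord3; move: i mi; apply: ord3P => /=; lia.
  - move=> v Qv; exists i => j; rewrite mul1r subrK.
    have := mb _ o0 Qv; have := mb _ o1 Qv; have := mb _ o2 Qv.
    have := sm _ Qv; move: j; apply: ord3P; lia.
- exists m, true; split.
  - by move=> i j; have := m0 j; case: eqP => _ /=; lia.
  - by rewrite sum_ord3 /=; lia.
  - move=> v Qv; have b0 := mb _ o0 Qv; have b1 := mb _ o1 Qv.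
    have b2 := mb _ o2 Qv; have b := sm _ Qv.
    have [c|[c|c]] : v o0 = m o0 + 1 \/ v o1 = m o1 + 1 \/ v o2 = m o2 + 1 by lia.
    + by exists o0; apply: ord3P => /=; lia.
    + by exists o1; apply: ord3P => /=; lia.
    + by exists o2; apply: ord3P => /=; lia.
- exists (fun j => m j + 1), false; split.
  - by move=> i j; have := m0 j; case: eqP => _ /=; lia.
  - by rewrite sum_ord3 /=; lia.
  - move=> v Qv; have b0 := mb _ o0 Qv; have b1 := mb _ o1 Qv.
    have b2 := mb _ o2 Qv; have b := sm _ Qv.
    have [c|[c|c]] : v o0 = m o0 \/ v o1 = m o1 \/ v o2 = m o2 by lia.
    + by exists o0; apply: ord3P => /=; lia.
    + by exists o1; apply: ord3P => /=; lia.
    + by exists o2; apply: ord3P => /=; lia.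
Qed.

(** This and [col_slope] are the vectors [u] and [v] of [cell_weight_nat]: the coefficients of the
    two factors of the bilinear part of the height. *)
Definition row_slope (i : 'I_3) : int := (i == o2)%:R - (i == o1)%:R.
Definition col_slope (j : 'I_3) : int := (j == o1)%:R - (j == o0)%:R.
Definition cell_weight (s : bool) (i j : 'I_3) : int :=
  sg s * (2 * row_slope i * col_slope j).

Lemma cell_weight_natE s (i j : 'I_3) :
  (cell_weight_nat s (i : nat, j : nat))%:Z = cell_weight s i j + 2.
Proof. by case: s; move: i j; apply: ord3P; apply: ord3P. Qed.

Lemma swap_cliques_filter s K l (f : pred (nat * nat)) :
  (forall p q, p \in l -> q \in l -> f p -> f q -> swap_ok s K p q) ->
  [seq p <- l | f p] \in swap_cliques s K l.
Proof.
elim: l => [|p l IH] fl; first by rewrite inE.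
have IHl : [seq p <- l | f p] \in swap_cliques s K l.
  by apply: IH => a b al bl; apply: fl; rewrite inE ?al ?bl orbT.
rewrite /= mem_cat; case: ifPn => fp; last by rewrite IHl.
apply/orP; right; apply: map_f; rewrite mem_filter IHl andbT.
apply/allP => q; rewrite mem_filter => /andP[fq ql].
by apply: fl; rewrite ?inE ?eqxx ?ql ?orbT.
Qed.

Lemma mem_grid (p : nat * nat) : (p \in grid) = (p.1 < 3)%N && (p.2 < 3)%N.
Proof.
case: p => i j; apply/allpairsP/andP => [[ab []]|[i3 j3]].
  by rewrite !mem_iota => a3 b3 [-> ->].
by exists (i, j); rewrite !mem_iota.
Qed.

(** Transfers the finite check to arbitrary bounds [gamma]. For two upward triangles the excluded
    Birkhoff pattern has bounds of sum 3, which the first hypothesis rules out. *)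
Lemma local_exposure (e1 e2 : bool) (gamma : 'I_3 -> int) (F : 'I_3 -> 'I_3 -> bool) :
  let K i j := forall k, sg e1 * (k == i)%:R + sg e2 * (k == j)%:R <= gamma k in
  let w := cell_weight (e1 == e2) in
  (e1 -> e2 -> 4 <= \sum_k gamma k) -> (exists i j, F i j) ->
  (forall i j, F i j -> K i j) ->
  (forall i j i' j', F i j -> F i' j' -> K i j' -> K i' j ->
    w i j + w i' j' <= w i j' + w i' j) ->
  exists a b : 'I_3 -> int, [/\ forall i, -12 <= a i <= 12,
    forall j, -12 <= b j <= 12 &
    forall i j, K i j -> a i + b j <= w i j /\ (a i + b j == w i j) = F i j].
Proof.
move=> K w g4 [i0 [j0 F00]] FK Fw.
(* After the shift, each triangle contributes 0 or 1 to a coordinate, so capping the bound at 2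
   changes nothing; a member of [F] shows that it is not negative. *)
pose g (k : 'I_3) := absz (Order.min 2 (gamma k + (~~ e1)%:R + (~~ e2)%:R)).
have gE k : (g k)%:Z = Order.min 2 (gamma k + (~~ e1)%:R + (~~ e2)%:R).
  rewrite gez0_abs // le_min /=; have := FK _ _ F00 k.
  by rewrite /sg; case: (e1); case: (e2) => /=; case: eqP; case: eqP => /=; lia.
pose gs := [:: g o0; g o1; g o2].
pose f (p : nat * nat) := F (inord p.1) (inord p.2).
pose Kl := [seq p <- grid | in_cell e1 e2 gs p].
have KlE (i j : 'I_3) : (i : nat, j : nat) \in Kl <-> K i j.
  rewrite mem_filter mem_grid /in_cell [(_, _).1]/= [(_, _).2]/= !ltn_ord !andbT.
  have E (k : 'I_3) :
      (((i == k :> nat) == e1) + ((j == k :> nat) == e2) <= nth 0 gs k)%N =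
      (sg e1 * (k == i)%:R + sg e2 * (k == j)%:R <= gamma k).
    rewrite (_ : nth 0%N gs k = g k); last by move: (k); apply: ord3P.
    rewrite -lez_nat gE ![k == _]eq_sym.
    rewrite -!(inj_eq val_inj) /=.
    by rewrite /sg; case: (e1); case: (e2) => /=; case: eqP; case: eqP => /=; lia.
  split=> [/allP cK k|Kij]; first by rewrite -E; apply: (cK k); rewrite mem_iota /=.
  by apply/allP => k; rewrite mem_iota => k3; have := Kij (Ordinal k3); rewrite -E.
have chk : exposure_check e1 e2 gs.
  have gin k : g k \in iota 0 3.
    by rewrite mem_iota /= -ltz_nat gE; lia.
  have bin e : e \in [:: true; false] by case: e.
  have := exposure_checkP => /allP/(_ e1 (bin e1))/allP/(_ e2 (bin e2)).
  move=> /allP/(_ _ (gin o0))/allP/(_ _ (gin o1))/allP/(_ _ (gin o2)).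
  move=> /orP[/and3P[E1 E2]|//]; have := g4 E1 E2; rewrite sum_ord3 => g4'.
  move=> /eqP[/(congr1 Posz) h0 /(congr1 Posz) h1 /(congr1 Posz) h2].
  by move: h0 h1 h2; rewrite !gE E1 E2; lia.
move: chk => /allP; rewrite -/Kl => /(_ [seq p <- Kl | f p]).
rewrite swap_cliques_filter => [|p q pK qK fp fq]; last first.
  move: pK qK (pK) (qK); rewrite {1 2}/Kl !mem_filter !mem_grid.
  move=> /and3P[_ p1 p2] /and3P[_ q1 q2] pK qK.
  move: fp fq pK qK; case: p p1 p2 => p1 p2 /= p13 p23.
  case: q q1 q2 => q1 q2 /= q13 q23; rewrite /f /swap_ok /=.
  have iE a (a3 : (a < 3)%N) : inord a = Ordinal a3.
    by apply: val_inj; rewrite /= inordK.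
  rewrite (iE _ p13) (iE _ p23) (iE _ q13) (iE _ q23).
  move=> fp fq _ _; apply/implyP => /andP[].
  move=> /(KlE (Ordinal p13) (Ordinal q23)) K1.
  move=> /(KlE (Ordinal q13) (Ordinal p23)) K2.
  have := Fw _ _ _ _ fp fq K1 K2.
  have := cell_weight_natE (e1 == e2) (Ordinal p13) (Ordinal p23).
  have := cell_weight_natE (e1 == e2) (Ordinal q13) (Ordinal q23).
  have := cell_weight_natE (e1 == e2) (Ordinal p13) (Ordinal q23).
  have := cell_weight_natE (e1 == e2) (Ordinal q13) (Ordinal p23).
  by rewrite /= /w; lia.
move=> /(_ isT); set xy := iter _ _ _; case: xy => x y /=.
rewrite /exposed_by all_cat => /andP[/allP xyK /andP[/allP x12 /allP y12]].
have nth12 (z : seq nat) k : {in z, forall n, (n <= 12)%N} -> (nth 0 z k <= 12)%N.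
  by move=> z12; have [/(mem_nth 0)/z12//|/(nth_default 0)->] := ltnP k (size z).
exists (fun i => - (nth 0%N x i)%:Z), (fun j => (nth 0%N y j)%:Z); split.
- by move=> i; have := nth12 x i x12; lia.
- by move=> i; have := nth12 y i y12; lia.
move=> i j Kij; have Kl_ij := (KlE i j).2 Kij.
have := xyK _ Kl_ij; rewrite mem_filter Kl_ij andbT /f /= !inord_val.
have := cell_weight_natE (e1 == e2) i j; rewrite -/w /=.
move=> E /andP[le /eqP <-]; split; first by lia.
by apply/eqP/eqP; lia.
Qed.

Lemma mx_complement (p q p' : 'M[int]_3) i j :
  (p + q - p') i j = p i j + q i j - p' i j.
Proof. by rewrite !mxE. Qed.

(** For use with the differences of a pair of points and of its balanced replacement, which agree
    modulo 2. *)
Lemma sqr_same_parity (d k : int) : `|d| <= 1 ->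
  d ^+ 2 <= (d + 2 * k) ^+ 2 /\
  (2 <= `|d + 2 * k| -> d ^+ 2 + 3 <= (d + 2 * k) ^+ 2).
Proof.
move=> d1; have [->|[->|->]] : d = 0 \/ d = 1 \/ d = -1 by lia.
- by split; nia.
- by split; nia.
- by split; nia.
Qed.

Lemma cross_bound (x y z w : int) :
  `|2 * ((x - y) * (z - w))| <= 2 * (x ^+ 2 + y ^+ 2 + z ^+ 2 + w ^+ 2).
Proof.
have h1 := sqr_ge0 (x - y + z - w); have h2 := sqr_ge0 (x - y - z + w).
have h3 := sqr_ge0 (x + y); have h4 := sqr_ge0 (z + w).
by rewrite ler_norml; apply/andP; split; lra.
Qed.

Lemma sum_indicator (i : 'I_3) (s : int) : \sum_j s * (j == i)%:R = s.
Proof. by rewrite -mulr_sumr sum_ord3; move: i; apply: ord3P; rewrite /= mulr1. Qed.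

(** Makes the quadratic part of the height single out the corners of a unit triangle. *)
Lemma unit_vector (x : 'I_3 -> int) e : \sum_i x i = sg e ->
  1 <= \sum_i x i ^+ 2 /\
  ((exists i, forall j, x j = sg e * (j == i)%:R) \/ 2 <= \sum_i x i ^+ 2).
Proof.
rewrite !sum_ord3 => sx.
have [s2|s1] := leP 2 (x o0 ^+ 2 + x o1 ^+ 2 + x o2 ^+ 2).
  by split; [apply: le_trans s2 | right].
have sq (y : int) : y ^+ 2 < 2 -> y = -1 \/ y = 0 \/ y = 1.
  move=> y2; have : -1 <= y <= 1 by apply/andP; split; nia.
  by lia.
have g0 := sqr_ge0 (x o0); have g1 := sqr_ge0 (x o1); have g2 := sqr_ge0 (x o2).
have c0 : x o0 ^+ 2 < 2 by lra.
have c1 : x o1 ^+ 2 < 2 by lra.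
have c2 : x o2 ^+ 2 < 2 by lra.
move: sx s1; rewrite /sg {g0 g1 g2}.
case: (sq _ c0) => [h0|[h0|h0]]; case: (sq _ c1) => [h1|[h1|h1]];
  case: (sq _ c2) => [h2|[h2|h2]]; rewrite h0 h1 h2; case: e => // _ _;
  split=> //; left; solve
    [ by exists o0; apply: ord3P; rewrite ?h0 ?h1 ?h2
    | by exists o1; apply: ord3P; rewrite ?h0 ?h1 ?h2
    | by exists o2; apply: ord3P; rewrite ?h0 ?h1 ?h2 ].
Qed.

(** * Heights of lattice points and compatible pairs *)

Section Transportation.
Variables r c : 'I_3 -> int.
Implicit Types M N p q : 'M[int]_3.

Definition transport M := [/\ forall i j, 0 <= M i j,
  forall i, \sum_j M i j = r i & forall j, \sum_i M i j = c j].

(** The midpoint of [p] and [q] lies in the box between the entrywise floor [l] and ceiling [u] of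
    its entries; by [box_hull] this box contains an integral point with the same line sums. *)
Lemma half_rounding (R : realType) p q : transport p -> transport q ->
  exists2 p', transport p' & transport (p + q - p') /\
    forall i j, `|2 * p' i j - p i j - q i j| <= 1.
Proof.
move=> [p0 pr pc] [q0 qr qc].
pose l i j := ((p i j + q i j) %/ 2)%Z.
pose u i j := l i j + ((p i j + q i j) %% 2)%Z.
pose x : 'M[R]_3 := \matrix_(i, j) (2^-1 * (p i j + q i j)%:~R).
have bx : box l u r c x.
  split=> [i j|i|j].
  - rewrite mxE mulrC ler_pdivlMr ?ltr0n // ler_pdivrMr ?ltr0n //.
    rewrite -!(intrM _ _ 2) !ler_int /u /l.
    by apply/andP; split; lia.
  - under eq_bigr do rewrite mxE intrD.
    by rewrite -mulr_sumr big_split /= -!rmorph_sum pr qr /=; field.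
  - under eq_bigr do rewrite mxE intrD.
    by rewrite -mulr_sumr big_split /= -!rmorph_sum pc qc /=; field.
have [[|n] [v [w [vX _ w1 _]]]] := box_hull bx.
  by move/eqP: w1; rewrite big_ord0 eq_sym oner_eq0.
have [[yb yr yc] yZ] := vX ord0.
pose p' : 'M[int]_3 := \matrix_(i, j) Num.floor (v ord0 i j).
have p'E i j : (p' i j)%:~R = v ord0 i j by rewrite mxE floorK.
have p'lu i j : l i j <= p' i j <= u i j.
  by rewrite -!(ler_int R) p'E.
have p'r i : \sum_j p' i j = r i.
  apply: (@intr_inj R); rewrite rmorph_sum /= -yr.
  by apply: eq_bigr => j _; rewrite p'E.
have p'c j : \sum_i p' i j = c j.
  apply: (@intr_inj R); rewrite rmorph_sum /= -yc.
  by apply: eq_bigr => i _; rewrite p'E.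
exists p'; first split=> // i j.
  by have := p'lu i j; have := p0 i j; have := q0 i j; rewrite /l; lia.
split; last by move=> i j; have := p'lu i j; rewrite /u /l; lia.
split=> [i j|i|j].
- by have := p'lu i j; have := p0 i j; have := q0 i j; rewrite mx_complement /u /l; lia.
- under eq_bigr do rewrite mx_complement.
  by rewrite big_split /= sumrN p'r big_split /= pr qr; lia.
- under eq_bigr do rewrite mx_complement.
  by rewrite big_split /= sumrN p'c big_split /= pc qc; lia.
Qed.

Variables i0 i1 i2 : 'I_3.
Hypotheses (i01 : i0 != i1) (i02 : i0 != i2) (i12 : i1 != i2).

Lemma sum_rows (V : nmodType) (f : 'I_3 -> V) :
  \sum_i f i = f i0 + (f i1 + f i2).
Proof.
rewrite (bigD1 i0) // (bigD1 i1) 1?eq_sym // (bigD1 i2) /=; last first.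
  by rewrite eq_sym i02 eq_sym.
rewrite big1 ?addr0 // => k /andP[/andP[k0 k1] k2].
by case: (ord3_cases k i01 i02 i12) => kE; rewrite kE eqxx in k0 k1 k2.
Qed.

(** The ring is a parameter because the height is computed over the integers and used over the
    reals. *)
Definition quadratic_height (A : comNzRingType) (M : 'M[A]_3) : A :=
  100%:R * \sum_b (M i1 b ^+ 2 + M i2 b ^+ 2) +
  2%:R * ((M i1 o2 - M i1 o1) * (M i2 o1 - M i2 o0)).

Definition transport_compatible p q := forall p' q',
  transport p' -> transport q' -> p + q = p' + q' ->
  quadratic_height p + quadratic_height q <=
  quadratic_height p' + quadratic_height q'.

Lemma transport_row0 M b : transport M -> M i0 b = c b - M i1 b - M i2 b.
Proof. by case=> _ _ /(_ b); rewrite sum_rows; lia. Qed.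

(* If some entry of [p - q] in rows [i1], [i2] were at least 2, replacing
   [p] and [q] by balanced roundings of their midpoint would lower the
   quadratic part of the height more than the bilinear part can raise it. *)
Lemma compatible_close (R : realType) p q : transport p -> transport q ->
  transport_compatible p q ->
  forall b, p i1 b - q i1 b <= 1 /\ p i2 b - q i2 b <= 1.
Proof.
move=> tp tq cpq; have [p' tp' [tq' p'd]] := half_rounding R tp tq.
have := cpq p' (p + q - p') tp' tq'; rewrite [p' + _]addrC subrK => /(_ erefl).
rewrite /quadratic_height !sum_ord3 !mx_complement.
pose d i b := 2 * p' i b - p i b - q i b; pose D i b := p i b - q i b.
have DE i b : D i b = d i b + 2 * (p i b - p' i b) by rewrite /D /d; ring.
have le i b : d i b ^+ 2 <= D i b ^+ 2.
  by rewrite DE; apply: (sqr_same_parity _ (p'd i b)).1.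
have lt i b : 2 <= `|D i b| -> d i b ^+ 2 + 3 <= D i b ^+ 2.
  by rewrite DE; apply: (sqr_same_parity _ (p'd i b)).2.
have d1 i b : d i b ^+ 2 <= 1.
  by have := p'd i b; rewrite -/(d i b) => d1; nia.
pose S (f : 'I_3 -> 'I_3 -> int) := f i1 o0 ^+ 2 + f i1 o1 ^+ 2 + f i1 o2 ^+ 2 +
  (f i2 o0 ^+ 2 + f i2 o1 ^+ 2 + f i2 o2 ^+ 2).
pose X (f : 'I_3 -> 'I_3 -> int) := 2 * ((f i1 o2 - f i1 o1) * (f i2 o1 - f i2 o0)).
(* For a quadratic form, the total on a pair is half the sum of its values at the sum and at the
   difference of the pair; the sums agree, so only the differences [D] and [d] are compared. *)
move=> H; have {}H : 100 * S D + X D <= 100 * S d + X d.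
  by move: H; rewrite /S /X /D /d; lra.
have X_le f : `|X f| <= 2 * S f.
  apply: le_trans (cross_bound _ _ _ _) _; rewrite ler_pM2l // /S.
  have := sqr_ge0 (f i1 o0); have := sqr_ge0 (f i2 o2); lra.
(* The bound on [X] turns [H] into [98 * S D <= 102 * S d], and [S d <= 6]. This is what the factor
   100 is for. *)
have SdD : S D < S d + 3.
  have Sd : S d <= 6.
    have := (d1 i1 o0, d1 i1 o1, d1 i1 o2, (d1 i2 o0, d1 i2 o1, d1 i2 o2)).
    by rewrite /S => -[[[? ?] ?] [[? ?] ?]]; lra.
  have := X_le D; have := X_le d; rewrite !ler_norml => /andP[_ Xd] /andP[XD _].
  move: H Sd Xd XD; move: (S D) (S d) (X D) (X d) => a b e f; lra.
have close i b : i \in [:: i1; i2] -> D i b <= 1.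
  move=> ii; rewrite leNgt; apply/negP; rewrite -lezD1 => D2.
  have := lt _ _ (le_trans D2 (ler_norm _)); move: SdD; rewrite /S {D2}.
  have l10 := le i1 o0; have l11 := le i1 o1; have l12 := le i1 o2.
  have l20 := le i2 o0; have l21 := le i2 o1; have l22 := le i2 o2.
  move: ii; rewrite !inE => /orP[] /eqP ->; move: b; apply: ord3P; lra.
by move=> b; split; apply: close; rewrite !inE eqxx ?orbT.
Qed.

(* The unit triangle with vertices [m + sg e * e_i] lies in the nonnegative
   part of the plane of coordinate sum [s]. *)
Definition alcove_corner (m : 'I_3 -> int) (e : bool) (s : int) :=
  (forall i j, 0 <= m j + sg e * (j == i)%:R) /\ \sum_j m j + sg e = s.

Definition cell_point m1 e1 m2 e2 (i j : 'I_3) : 'M[int]_3 :=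
  \matrix_(a, b) if a == i1 then m1 b + sg e1 * (b == i)%:R
    else if a == i2 then m2 b + sg e2 * (b == j)%:R
    else c b - (m1 b + sg e1 * (b == i)%:R) - (m2 b + sg e2 * (b == j)%:R).

(** * Products of two unit triangles *)

Section Cell.
Hypothesis sum_rc : \sum_i r i = \sum_j c j.
Variables (m1 m2 : 'I_3 -> int) (e1 e2 : bool).
Hypotheses (corner1 : alcove_corner m1 e1 (r i1))
           (corner2 : alcove_corner m2 e2 (r i2)).
Let cell := cell_point m1 e1 m2 e2.

Lemma cell_row1 i j b : cell i j i1 b = m1 b + sg e1 * (b == i)%:R.
Proof. by rewrite mxE eqxx. Qed.

Lemma cell_row2 i j b : cell i j i2 b = m2 b + sg e2 * (b == j)%:R.
Proof. by rewrite mxE eqxx eq_sym (negPf i12). Qed.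

Lemma cell_row0 i j b : cell i j i0 b =
  c b - (m1 b + sg e1 * (b == i)%:R) - (m2 b + sg e2 * (b == j)%:R).
Proof. by rewrite mxE (negPf i01) (negPf i02). Qed.

Lemma rowsP (Q : 'I_3 -> Prop) : Q i0 -> Q i1 -> Q i2 -> forall i, Q i.
Proof. by move=> Q0 Q1 Q2 i; case: (ord3_cases i i01 i02 i12) => ->. Qed.

(** Rows [i1] and [i2] are nonnegative at all corners and row [i0] is defined by the column sums, so
    only the nonnegativity of row [i0] is at stake. *)
Lemma cell_transport i j : transport (cell i j) <->
  forall k, sg e1 * (k == i)%:R + sg e2 * (k == j)%:R <= c k - m1 k - m2 k.
Proof.
have [c1 s1] := corner1; have [c2 s2] := corner2.
split=> [[t0 _ _] k|K]; first by have := t0 i0 k; rewrite cell_row0; lia.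
split.
- apply: rowsP => k; rewrite ?cell_row0 ?cell_row1 ?cell_row2 //.
  by have := K k; lia.
- have S1 : \sum_b cell i j i1 b = r i1.
    by under eq_bigr do rewrite cell_row1; rewrite big_split /= sum_indicator.
  have S2 : \sum_b cell i j i2 b = r i2.
    by under eq_bigr do rewrite cell_row2; rewrite big_split /= sum_indicator.
  apply: rowsP => //.
  have -> : \sum_b cell i j i0 b =
      \sum_b (c b - cell i j i1 b - cell i j i2 b).
    by apply: eq_bigr => b _; rewrite cell_row0 cell_row1 cell_row2.
  rewrite !sumrB S1 S2 -sum_rc sum_rows; lia.
- by move=> b; rewrite sum_rows cell_row0 cell_row1 cell_row2; lia.
Qed.

Lemma transport_cell M i j : transport M ->
  (forall b, M i1 b = m1 b + sg e1 * (b == i)%:R) ->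
  (forall b, M i2 b = m2 b + sg e2 * (b == j)%:R) -> M = cell i j.
Proof.
move=> tM M1 M2; apply/matrixP => a b; move: a; apply: rowsP.
- by rewrite (transport_row0 b tM) cell_row0 M1 M2.
- by rewrite cell_row1.
- by rewrite cell_row2.
Qed.

Lemma cell_swap i j i' j' : cell i j + cell i' j' = cell i j' + cell i' j.
Proof.
apply/matrixP => a b; rewrite [LHS]mxE [RHS]mxE; move: a; apply: rowsP.
- by rewrite !cell_row0; ring.
- by rewrite !cell_row1.
- by rewrite !cell_row2 addrC.
Qed.

Lemma sg_eq : sg (e1 == e2) = sg e1 * sg e2.
Proof. by case: (e1); case: (e2). Qed.

(** Terms of the height depending on [i] alone or [j] alone cancel; only the bilinear part
    survives. *)
Lemma cell_height_swap i j i' j' : let w := cell_weight (e1 == e2) in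
  quadratic_height (cell i j) + quadratic_height (cell i' j') -
  quadratic_height (cell i j') - quadratic_height (cell i' j) =
  w i j + w i' j' - w i j' - w i' j.
Proof.
rewrite /quadratic_height !sum_ord3 !cell_row1 !cell_row2.
rewrite /cell_weight sg_eq /row_slope /col_slope ![o0 == _]eq_sym ![o1 == _]eq_sym.
rewrite ![o2 == _]eq_sym; ring.
Qed.

(* The height, up to an affine function, in the coordinates [x], [y] of rows
   [i1], [i2] relative to the corners, minus the potentials. *)
Definition cell_potential (a b : 'I_3 -> int) (x y : 'I_3 -> int) : int :=
  100 * (\sum_k x k ^+ 2 + \sum_k y k ^+ 2) +
  2 * ((x o2 - x o1) * (y o1 - y o0)) -
  sg e1 * (\sum_k a k * x k) - sg e2 * (\sum_k b k * y k).

Lemma cell_potential_corner a b x y i j :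
  (forall k, x k = sg e1 * (k == i)%:R) -> (forall k, y k = sg e2 * (k == j)%:R) ->
  cell_potential a b x y = 200 + cell_weight (e1 == e2) i j - a i - b j.
Proof.
move=> xE yE; rewrite /cell_potential !sum_ord3 !xE !yE /cell_weight sg_eq.
rewrite /row_slope /col_slope; move: i j {xE yE}.
by apply: ord3P; apply: ord3P => /=; case: (e1); case: (e2); rewrite /sg; ring.
Qed.

(** Away from the corners the sum [S] of all squares is at least 3. The bilinear term is at most
    [2 * S] and the potentials contribute at most [12 * S] in absolute value, so the potential is at
    least [86 * 3]. *)
Lemma cell_potential_gt a b x y :
  (forall k, -12 <= a k <= 12) -> (forall k, -12 <= b k <= 12) ->
  \sum_k x k = sg e1 -> \sum_k y k = sg e2 ->
  (exists i j, (forall k, x k = sg e1 * (k == i)%:R) /\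
               (forall k, y k = sg e2 * (k == j)%:R)) \/
  200 < cell_potential a b x y.
Proof.
move=> a12 b12 /unit_vector[x1 x2] /unit_vector[y1 y2].
have lin e (z u : 'I_3 -> int) : (forall k, -12 <= u k <= 12) ->
    sg e * (\sum_k u k * z k) <= 12 * \sum_k z k ^+ 2.
  move=> u12; rewrite !mulr_sumr; apply: ler_sum => k _.
  have lin1 (d : int) : -12 <= d <= 12 -> d * z k <= 12 * z k ^+ 2.
    have [z1 z2] : z k <= z k ^+ 2 /\ - z k <= z k ^+ 2 by split; nia.
    move=> /andP[d1 d2]; have [z0|z0] := leP 0 (z k).
      have := mulr_ge0 (_ : 0 <= 12 - d) z0; lra.
    have := mulr_ge0 (_ : 0 <= 12 + d) (_ : 0 <= - z k); lra.
  rewrite mulrA; apply: lin1; have := u12 k.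
  by case: e; rewrite /sg; lra.
have big : 3 <= \sum_k x k ^+ 2 + \sum_k y k ^+ 2 -> 200 < cell_potential a b x y.
  have := lin e1 x a a12; have := lin e2 y b b12; rewrite /cell_potential.
  have := cross_bound (x o2) (x o1) (y o1) (y o0).
  move: (sg e1 * _) (sg e2 * _) => s t; rewrite !sum_ord3.
  have := sqr_ge0 (x o0); have := sqr_ge0 (y o2).
  rewrite ler_norml => ? ? /andP[? ?] ? ? ?; lra.
case: x2 => [[i xi]|x2]; last by right; apply: big; lra.
case: y2 => [[j yj]|y2]; last by right; apply: big; lra.
by left; exists i, j.
Qed.

(** Its coefficients of [M i1 k] and [M i2 k] become the exposing functional of [exposed_cell]. *)
Lemma cell_potentialE a b M :
  cell_potential a b (fun k => M i1 k - m1 k) (fun k => M i2 k - m2 k) =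
  quadratic_height M + \sum_k (
    (- 200 * m1 k - 2 * (m2 o1 - m2 o0) * row_slope k - sg e1 * a k) * M i1 k +
    (- 200 * m2 k - 2 * (m1 o2 - m1 o1) * col_slope k - sg e2 * b k) * M i2 k) +
  (100 * (\sum_k m1 k ^+ 2 + \sum_k m2 k ^+ 2) +
   2 * ((m1 o2 - m1 o1) * (m2 o1 - m2 o0)) +
   sg e1 * (\sum_k a k * m1 k) + sg e2 * (\sum_k b k * m2 k)).
Proof.
rewrite /cell_potential /quadratic_height !sum_ord3.
by rewrite /row_slope /col_slope /=; ring.
Qed.

Lemma cell_inj i j i' j' : cell i j = cell i' j' -> i = i' /\ j = j'.
Proof.
have one (e : bool) (k k' : 'I_3) (m : int) :
    m + sg e * (k == k)%:R = m + sg e * (k == k')%:R -> k = k'.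
  by rewrite eqxx; case: eqP => // _ /addrI; case: e.
move=> E; split.
  by have := congr1 (fun M : 'M[int]_3 => M i1 i) E; rewrite !cell_row1 => /one.
by have := congr1 (fun M : 'M[int]_3 => M i2 j) E; rewrite !cell_row2 => /one.
Qed.

Definition cell_mx (R : realType) i j : 'M[R]_3 := map_mx intr (cell i j).

(** Row [i1] of a combination records the row sums of the weight array [z], just as row [i2] records
    its column sums; integrality of the combination thus becomes integrality of line sums. *)
Lemma sum_cell_row1 (R : realType) (z : 'I_3 -> 'I_3 -> R) b :
  (\sum_i \sum_j z i j *: cell_mx R i j) i1 b =
  (m1 b)%:~R * (\sum_i \sum_j z i j) + (sg e1)%:~R * \sum_j z b j.
Proof.
rewrite summxE mulr_sumr (bigD1 b) //= summxE.
rewrite [X in _ = X + _](bigD1 b) //= addrAC mulr_sumr mulr_sumr -big_split /=.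
congr (_ + _).
  apply: eq_bigr => j _; rewrite mxE mxE cell_row1 eqxx mulr1 intrD; ring.
apply: eq_bigr => i ib; rewrite summxE mulr_sumr; apply: eq_bigr => j _.
by rewrite mxE mxE cell_row1 eq_sym (negPf ib) mulr0 addr0 mulrC.
Qed.

Lemma sum_cell_row2 (R : realType) (z : 'I_3 -> 'I_3 -> R) b :
  (\sum_i \sum_j z i j *: cell_mx R i j) i2 b =
  (m2 b)%:~R * (\sum_i \sum_j z i j) + (sg e2)%:~R * \sum_i z i b.
Proof.
rewrite exchange_big [in RHS]exchange_big /=.
rewrite summxE mulr_sumr (bigD1 b) //= summxE.
rewrite [X in _ = X + _](bigD1 b) //= addrAC mulr_sumr mulr_sumr -big_split /=.
congr (_ + _).
  apply: eq_bigr => j _; rewrite mxE mxE cell_row2 eqxx mulr1 intrD; ring.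
apply: eq_bigr => i ib; rewrite summxE mulr_sumr; apply: eq_bigr => j _.
by rewrite mxE mxE cell_row2 eq_sym (negPf ib) mulr0 addr0 mulrC.
Qed.

Lemma sum_cell_row0 (R : realType) (z : 'I_3 -> 'I_3 -> R) b :
  (\sum_i \sum_j z i j *: cell_mx R i j) i0 b =
  (c b)%:~R * (\sum_i \sum_j z i j) -
  (\sum_i \sum_j z i j *: cell_mx R i j) i1 b -
  (\sum_i \sum_j z i j *: cell_mx R i j) i2 b.
Proof.
rewrite !summxE mulr_sumr -!sumrB; apply: eq_bigr => i _.
rewrite !summxE mulr_sumr -!sumrB; apply: eq_bigr => j _.
have E a : (z i j *: cell_mx R i j) a b = z i j * (cell i j a b)%:~R.
  by rewrite mxE mxE.
by rewrite !E cell_row0 cell_row1 cell_row2 !rmorphB /=; ring.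
Qed.

Lemma sg_intr_unit (R : realType) e (x : R) :
  (sg e)%:~R * x \is a Num.int -> x \is a Num.int.
Proof. by case: e; rewrite /sg ?mul1r // mulrN1z mulN1r rpredN. Qed.

(* The points of a product of two simplices correspond to the edges of
   K_{3,3}, and affine dependencies to its cycles: a representation with
   fractional weights would contain a cycle of fractional weights. *)
Lemma cell_integral_weights (R : realType) (S : 'I_3 -> 'I_3 -> bool)
    (w : 'I_3 -> 'I_3 -> R) :
  (forall z : 'I_3 -> 'I_3 -> R, (forall i j, z i j != 0 -> S i j) ->
     \sum_i \sum_j z i j = 0 -> \sum_i \sum_j z i j *: cell_mx R i j = 0 ->
     forall i j, z i j = 0) ->
  (forall i j, w i j != 0 -> S i j) -> \sum_i \sum_j w i j = 1 ->
  @integer_matrices R 3 3 (\sum_i \sum_j w i j *: cell_mx R i j) ->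
  forall i j, w i j \is a Num.int.
Proof.
move=> indep wS w1 wZ i j; apply: contrapT => /negP wij.
have wrow a : \sum_b w a b \is a Num.int.
  apply: (@sg_intr_unit _ e1); have := wZ i1 a.
  by rewrite sum_cell_row1 w1 mulr1 rpredDl // intr_int.
have wcol b : \sum_a w a b \is a Num.int.
  apply: (@sg_intr_unit _ e2); have := wZ i2 b.
  by rewrite sum_cell_row2 w1 mulr1 rpredDl // intr_int.
have [||d [dS _ dr dc [a [b dab]]]] :=
    @leafless_cycle (fun a b => w a b \isn't a Num.int) i j wij.
- by move=> a b wab; apply: sum_not_int (wrow a) wab.
- by move=> a b wab; apply: sum_not_int (wcol b) wab.
pose z a b : R := (d a b)%:~R.
have zr a' : \sum_b z a' b = 0 by rewrite /z -rmorph_sum dr.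
have zc b' : \sum_a z a b' = 0 by rewrite /z -rmorph_sum dc.
have z0 : \sum_a \sum_b z a b = 0 by rewrite big1.
have zmx : \sum_a \sum_b z a b *: cell_mx R a b = 0.
  have E1 b' : (\sum_a \sum_b z a b *: cell_mx R a b) i1 b' = 0.
    by rewrite sum_cell_row1 z0 zr !mulr0 addr0.
  have E2 b' : (\sum_a \sum_b z a b *: cell_mx R a b) i2 b' = 0.
    by rewrite sum_cell_row2 z0 zc !mulr0 addr0.
  apply/matrixP => a' b'; rewrite [RHS]mxE; move: a'; apply: rowsP => //.
  by rewrite sum_cell_row0 E1 E2 z0 mulr0 !subr0.
have := indep z _ z0 zmx a b.
rewrite /z => /(_ _)/eqP; rewrite intr_eq0 (negPf dab) => H.
suff : false by []; apply: H => a' b'; rewrite intr_eq0 => dab'.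
apply: wS; apply: contraTneq (dS _ _ dab') => ->.
by rewrite negbK rpred0.
Qed.

(** [local_exposure] separates [Q] from the other corners of the cell, and [cell_potential_gt] from
    all points outside it. *)
Lemma exposed_cell (Q : set 'M[int]_3) : 2 <= r i0 -> Q !=set0 ->
  Q `<=` transport ->
  (forall p q, Q p -> Q q -> p != q -> transport_compatible p q) ->
  (forall M, Q M -> exists i j, M = cell i j) ->
  exists k1 k2 t, forall M, transport M ->
    let v := quadratic_height M + \sum_b (k1 b * M i1 b + k2 b * M i2 b) in
    t <= v /\ (v = t <-> Q M).
Proof.
move=> r2 [M0 QM0] Qt Qc Qcell.
pose F i j := `[<Q (cell i j)>].
have [|||| a [b [a12 b12 ab]]] := @local_exposure e1 e2 (fun k => c k - m1 k - m2 k) F.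
(* For two upward triangles the bounds sum to [r i0 + 2], so [2 <= r i0] excludes the Birkhoff
   pattern. *)
- move=> E1 E2; have := corner1.2; have := corner2.2.
  rewrite !sumrB E1 E2 -sum_rc (sum_rows r) /sg /= => <- <-; lra.
- have [i [j Mij]] := Qcell _ QM0.
  by exists i, j; apply/asboolP; rewrite -Mij.
- by move=> i j /asboolP/Qt/cell_transport.
- move=> i j i' j' /asboolP Fij /asboolP Fij' K1 K2.
  have [E|ne] := eqVneq (cell i j) (cell i' j').
    by have [-> ->] := cell_inj E.
  have := Qc _ _ Fij Fij' ne (cell i j') (cell i' j).
  move=> /(_ ((cell_transport _ _).2 K1) ((cell_transport _ _).2 K2) (cell_swap _ _ _ _)).
  have := cell_height_swap i j i' j'; rewrite /=; lra.
have potE := cell_potentialE a b.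
pose const : int := 100 * (\sum_k m1 k ^+ 2 + \sum_k m2 k ^+ 2) +
  2 * ((m1 o2 - m1 o1) * (m2 o1 - m2 o0)) +
  sg e1 * (\sum_k a k * m1 k) + sg e2 * (\sum_k b k * m2 k).
exists (fun k => - 200 * m1 k - 2 * (m2 o1 - m2 o0) * row_slope k - sg e1 * a k),
  (fun k => - 200 * m2 k - 2 * (m1 o2 - m1 o1) * col_slope k - sg e2 * b k),
  (200 - const) => M tM v.
have vE : v = cell_potential a b (fun k => M i1 k - m1 k) (fun k => M i2 k - m2 k) - const.
  by rewrite potE -/const addrK.
have corner i j : M = cell i j ->
    cell_potential a b (fun k => M i1 k - m1 k) (fun k => M i2 k - m2 k) =
    200 + cell_weight (e1 == e2) i j - a i - b j.
  by move=> ->; apply: cell_potential_corner => k;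
    rewrite ?cell_row1 ?cell_row2 addrC addKr.
have QE i j : M = cell i j -> 200 - const <= v /\ (v = 200 - const <-> Q M).
  move=> Mij; rewrite vE (corner _ _ Mij).
  have Kij k : sg e1 * (k == i)%:R + sg e2 * (k == j)%:R <= c k - m1 k - m2 k.
    by move: k; apply/cell_transport; rewrite -Mij.
  have [le eqF] := ab i j Kij; split; first by lra.
  rewrite Mij; split=> [H|/asboolP QM].
    by apply/asboolP; rewrite -/(F i j) -eqF; apply/eqP; lra.
  by move: eqF; rewrite /F QM => /eqP; lra.
have [||[i [j [Mi Mj]]]|lt] := cell_potential_gt (x := fun k => M i1 k - m1 k)
  (y := fun k => M i2 k - m2 k) a12 b12.
- by case: tM => _ tr _; rewrite sumrB tr -corner1.2 addrAC subrr add0r.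
- by case: tM => _ tr _; rewrite sumrB tr -corner2.2 addrAC subrr add0r.
- apply: (QE i j); apply: transport_cell => // k.
    by rewrite -(Mi k); ring.
  by rewrite -(Mj k); ring.
split; first by rewrite vE; lra.
split; first by rewrite vE; lra.
by move=> QM; have [i [j /QE[_ [_]]]] := Qcell _ QM; apply.
Qed.

End Cell.

Lemma clique_in_cell (R : realType) (Q : set 'M[int]_3) :
  (forall i, 0 < r i) -> Q !=set0 -> Q `<=` transport ->
  (forall p q, Q p -> Q q -> p != q -> transport_compatible p q) ->
  exists m1 e1 m2 e2, [/\ alcove_corner m1 e1 (r i1),
    alcove_corner m2 e2 (r i2) &
    forall M, Q M -> exists i j, M = cell_point m1 e1 m2 e2 i j].
Proof.
move=> r0 [M0 QM0] Qt Qc.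
have close p q : Q p -> Q q -> forall b, p i1 b - q i1 b <= 1 /\ p i2 b - q i2 b <= 1.
  move=> Qp Qq; have [->|pq] := eqVneq p q; first by move=> b; rewrite !subrr.
  exact: compatible_close R _ _ (Qt _ Qp) (Qt _ Qq) (Qc _ _ Qp Qq pq).
have rowcell i : (forall p q, Q p -> Q q -> forall b, p i b - q i b <= 1) ->
    exists m e, alcove_corner m e (r i) /\
      forall M, Q M -> exists k, forall b, M i b = m b + sg e * (b == k)%:R.
  move=> ci; have [||||| m [e [m0 ms mQ]]] := @alcove [set (M i) | M in Q] (r i).
  - by exists (M0 i), M0.
  - exact: r0.
  - by move=> _ [M /Qt[M_ge0 _ _] <-].
  - by move=> _ [M /Qt[_ Mr _] <-].
  - by move=> _ _ [p Qp <-] [q Qq <-]; apply: ci.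
  by exists m, e; split=> // M QM; apply: mQ; exists M.
have [|m1 [e1 [c1 Q1]]] := rowcell i1.
  by move=> p q Qp Qq b; case: (close _ _ Qp Qq b).
have [|m2 [e2 [c2 Q2]]] := rowcell i2.
  by move=> p q Qp Qq b; case: (close _ _ Qp Qq b).
exists m1, e1, m2, e2; split=> // M QM.
have [i Mi] := Q1 M QM; have [j Mj] := Q2 M QM.
by exists i, j; apply: transport_cell => //; apply: Qt.
Qed.

End Transportation.

(** * The triangulation of the transportation polytope *)

Section RowFunctional.
Variables (R : realType) (i1 i2 : 'I_3) (k1 k2 : 'I_3 -> int).

Definition row_functional (X : 'M[R]_3) : R :=
  \sum_b ((k1 b)%:~R * X i1 b + (k2 b)%:~R * X i2 b).

Fact row_functional_is_linear : linear_for *%R row_functional.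
Proof.
move=> a X Y; rewrite /row_functional mulr_sumr -big_split /=.
by apply: eq_bigr => b _; rewrite !mxE; ring.
Qed.

HB.instance Definition _ := GRing.isLinear.Build R 'M[R]_3 R *%R row_functional
  row_functional_is_linear.

End RowFunctional.

Section TransportationPolytope.
Variables (R : realType) (r c : 'I_3 -> int).
Let L := @integer_matrices R 3 3.
Let P := @transportation_polytope R 3 3 r c.
Let emb : 'M[int]_3 -> 'M[R]_3 := map_mx intr.

Lemma emb_inj : injective emb.
Proof.
move=> M N /matrixP MN; apply/matrixP => i j.
by have := MN i j; rewrite !mxE => /intr_inj.
Qed.

Lemma lattice_pointP X : (P `&` L) X <-> exists2 M, transport r c M & X = emb M.
Proof.
split=> [[[X0 Xr Xc] XZ]|[M [M0 Mr Mc] ->]].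
  have XE i j : X i j = (Num.floor (X i j))%:~R by rewrite floorK //; apply: XZ.
  exists (\matrix_(i, j) Num.floor (X i j)); last first.
    by apply/matrixP => i j; rewrite !mxE.
  split=> [i j|i|j].
  - by rewrite mxE floor_ge0.
  - apply: (@intr_inj R); rewrite rmorph_sum /= -Xr.
    by apply: eq_bigr => j _; rewrite mxE.
  - apply: (@intr_inj R); rewrite rmorph_sum /= -Xc.
    by apply: eq_bigr => i _; rewrite mxE.
split; last by move=> i j; rewrite mxE intr_int.
split=> [i j|i|j]; first by rewrite mxE ler0z.
- by rewrite -Mr rmorph_sum; apply: eq_bigr => j _; rewrite mxE.
- by rewrite -Mc rmorph_sum; apply: eq_bigr => i _; rewrite mxE.
Qed.

Lemma transport_le M i j : transport r c M -> 0 <= M i j <= r i.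
Proof.
move=> [M0 Mr _]; rewrite M0 -Mr (bigD1 j) //= lerDl.
by apply: sumr_ge0 => k _; apply: M0.
Qed.

Lemma finite_lattice_points : finite_set (P `&` L).
Proof.
pose B := (\sum_i absz (r i)).+1.
pose f (N : 'M['I_B]_3) : 'M[R]_3 := map_mx (fun k : 'I_B => (k : nat)%:R) N.
apply: (@sub_finite_set _ _ (f @` setT)); last exact/finite_image/finite_finset.
move=> X /lattice_pointP[M tM ->].
have MB i j : (absz (M i j) < B)%N.
  have /andP[M0 Mr] := transport_le i j tM.
  rewrite ltnS (bigD1 i) //=; apply: leq_trans (leq_addr _ _).
  by rewrite -lez_nat !gez0_abs // (le_trans M0).
exists (\matrix_(i, j) Ordinal (MB i j)) => //.
apply/matrixP => i j; rewrite !mxE /= -[LHS]/((absz (M i j))%:Z%:~R).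
by rewrite gez0_abs //; case: tM.
Qed.

Let A := fset_set (P `&` L).

Lemma lattice_pointsE : [set` A] = P `&` L.
Proof. by rewrite fset_setK //; exact: finite_lattice_points. Qed.

Lemma mem_lattice_points X : X \in A <-> exists2 M, transport r c M & X = emb M.
Proof. by rewrite -lattice_pointP -lattice_pointsE. Qed.

Lemma hullA : P = convex_hull [set` A].
Proof.
apply/seteqP; split=> X.
  (* Nonnegative entries are at most their row sum, so the bounds of the box cut nothing off. *)
  move=> [X0 Xr Xc]; have bX : box (fun _ _ => 0) (fun i _ => r i) r c X.
    split=> // i j; rewrite X0 /= -Xr (bigD1 j) //= lerDl.
    by apply: sumr_ge0 => k _; apply: X0.
  have [n [v [w [vX w0 w1 ->]]]] := box_hull bX.
  exists n, v, w; split=> // i; rewrite lattice_pointsE.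
  have [[vb vr vc] vZ] := vX i; split=> //; split=> // a b.
  by have /andP[] := vb a b.
move=> [n [v [w [vA w0 w1 ->]]]].
have vP k : P (v k) by have := vA k; rewrite lattice_pointsE => -[].
split=> [i j|i|j].
- rewrite summxE; apply: sumr_ge0 => k _; rewrite mxE mulr_ge0 //.
  by case: (vP k).
- under eq_bigr do rewrite summxE; rewrite exchange_big /=.
  rewrite -[RHS]mul1r -[X in _ = X * _]w1 mulr_suml; apply: eq_bigr => k _.
  under eq_bigr do rewrite mxE; rewrite -mulr_sumr.
  by case: (vP k) => _ ->.
- under eq_bigr do rewrite summxE; rewrite exchange_big /=.
  rewrite -[RHS]mul1r -[X in _ = X * _]w1 mulr_suml; apply: eq_bigr => k _.
  under eq_bigr do rewrite mxE; rewrite -mulr_sumr.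
  by case: (vP k) => _ _ ->.
Qed.

Variables (i0 i1 i2 : 'I_3).
Hypotheses (i01 : i0 != i1) (i02 : i0 != i2) (i12 : i1 != i2).
Hypotheses (r_gt0 : forall i, 0 < r i) (c_gt0 : forall j, 0 < c j).
Hypotheses (sum_rc : \sum_i r i = \sum_j c j) (r_ge2 : 2 <= r i0).

Let h : 'M[R]_3 -> R := quadratic_height i1 i2 (A := R).

Lemma height_emb M : h (emb M) = (quadratic_height i1 i2 M)%:~R.
Proof.
rewrite /h /quadratic_height !sum_ord3 !mxE.
by rewrite !(rmorph_nat, rmorphM, rmorphXn, rmorphB, rmorphD) /=.
Qed.

Section Clique.
Variable (G : {fset 'M[R]_3}).
Hypotheses (cG : clique A h G) (G0 : G != fset0).
Let Q := [set M | emb M \in G].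

Lemma preclique_neq0 : Q !=set0.
Proof.
have /fset0Pn[X XG] := G0; have /mem_lattice_points[M _ XM] := fsubsetP cG.1 _ XG.
by exists M; rewrite /Q /= -XM.
Qed.

Lemma preclique_transport : Q `<=` transport r c.
Proof.
by move=> M MG; have /mem_lattice_points[N tN /emb_inj ->] := fsubsetP cG.1 _ MG.
Qed.

Lemma preclique_compatible p q : Q p -> Q q -> p != q ->
  transport_compatible r c i1 i2 p q.
Proof.
move=> Qp Qq pq p' q' tp' tq' E.
have := cG.2 _ _ Qp Qq; rewrite (inj_eq emb_inj) => /(_ pq (emb p') (emb q')).
rewrite !height_emb -!intrD ler_int; apply.
- by apply/mem_lattice_points; exists p'.
- by apply/mem_lattice_points; exists q'.
- by rewrite -!map_mxD E.
Qed.

Lemma clique_exposed : exists phi : {scalar 'M[R]_3}, exists t, exposes A h phi t G.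
Proof.
have [m1 [e1 [m2 [e2 [c1 c2 Qcell]]]]] := clique_in_cell i01 i02 i12 R r_gt0
  preclique_neq0 preclique_transport preclique_compatible.
have [k1 [k2 [t kt]]] := exposed_cell i01 i02 i12 sum_rc c1 c2 r_ge2
  preclique_neq0 preclique_transport preclique_compatible Qcell.
exists (row_functional i1 i2 k1 k2), t%:~R => X /mem_lattice_points[M tM ->].
have -> : row_functional i1 i2 k1 k2 (emb M) + h (emb M) =
    (quadratic_height i1 i2 M + \sum_b (k1 b * M i1 b + k2 b * M i2 b))%:~R.
  rewrite height_emb [RHS]rmorphD [X in _ = _ + X]rmorph_sum [RHS]addrC.
  congr (_ + _).
  by apply: eq_bigr => b _; rewrite !mxE rmorphD !rmorphM.
rewrite ler_int eqr_int; have [le eq] := kt M tM; split=> //.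
by apply/eqP/idP => [/eq|MG]; [|apply/eq].
Qed.

End Clique.

(** The weights are extended by 0 to an array over all corners of the cell. Affine independence of
    the clique is the independence that [cell_integral_weights] asks for. *)
Lemma clique_integral_weights G w : clique A h G -> \sum_(g <- G) w g = 1 ->
  L (\sum_(g <- G) w g *: g) -> forall g, g \in G -> w g \is a Num.int.
Proof.
move=> cG w1 wL.
have G0 : G != fset0.
  by apply/eqP => G0; move/eqP: w1; rewrite G0 big_seq_fset0 eq_sym oner_eq0.
have [m1 [e1 [m2 [e2 [c1 c2 Qcell]]]]] := clique_in_cell i01 i02 i12 R r_gt0
  (preclique_neq0 cG G0) (preclique_transport cG) (preclique_compatible cG).
pose C (p : 'I_3 * 'I_3) := cell_mx c i1 i2 m1 m2 e1 e2 R p.1 p.2.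
have GC X : X \in G -> exists p, X = C p.
  move=> XG; have /mem_lattice_points[M _ XM] := fsubsetP cG.1 _ XG.
  have [|i [j Mij]] := Qcell M; first by rewrite /= -XM.
  by exists (i, j); rewrite XM Mij.
have Cinj : injective C.
  by move=> [a b] [a' b'] /emb_inj/(cell_inj i12)[/= -> ->].
have sumG (W : nmodType) (f : 'M[R]_3 -> W) :
    \sum_(g <- G) f g = \sum_i \sum_j if C (i, j) \in G then f (C (i, j)) else 0.
  rewrite pair_bigA /= big_seq.
  transitivity (\sum_(g <- G) \sum_p if C p == g then f (C p) else 0).
    rewrite -big_seq big_seq [RHS]big_seq; apply: eq_bigr => g /GC[p ->].
    rewrite (bigD1 p) //= eqxx big1 ?addr0 // => q qp.
    by rewrite (inj_eq Cinj) (negPf qp).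
  rewrite exchange_big /=; apply: eq_bigr => -[i j] _ /=; case: ifPn => CG.
    rewrite (big_fsetD1 (C (i, j))) //= eqxx big1_fset ?addr0 // => g.
    by rewrite !inE eq_sym => /andP[/negPf ->].
  rewrite big_seq big1 // => g gG; case: eqP => // Cg.
  by rewrite Cg gG in CG.
pose w' i j := if C (i, j) \in G then w (C (i, j)) else 0.
have w'E g : g \in G -> exists i j, w g = w' i j.
  by move=> gG; have [[i j] gC] := GC g gG; exists i, j; rewrite /w' -gC gG.
suff w'Z : forall i j, w' i j \is a Num.int.
  by move=> g /w'E[i [j ->]].
apply: (@cell_integral_weights c i0 i1 i2 i01 i02 i12 m1 m2 e1 e2 R
  (fun i j => C (i, j) \in G)).
- move=> z zG z0 zC i j; have [CG|] := boolP (C (i, j) \in G); last first.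
    by apply: contraNeq => /zG.
  pose u X := \sum_p z p.1 p.2 * (X == C p)%:R.
  have uC p : u (C p) = z p.1 p.2.
    rewrite /u (bigD1 p) //= eqxx mulr1 big1 ?addr0 // => q qp.
    by rewrite (inj_eq Cinj) eq_sym (negPf qp) mulr0.
  have zE a b : (if C (a, b) \in G then u (C (a, b)) else 0) = z a b.
    by rewrite uC; case: ifPn => //= /negP nG; apply/esym/eqP/negPn/negP => /zG.
  rewrite -(uC (i, j)); apply: (clique_affinely_independent clique_exposed cG) => //.
    by rewrite sumG -[RHS]z0; apply: eq_bigr => a _; apply: eq_bigr => b _; rewrite zE.
  rewrite sumG -[RHS]zC; apply: eq_bigr => a _; apply: eq_bigr => b _.
  by rewrite -[in RHS](zE a b); case: ifP; rewrite ?scale0r.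
- by move=> i j; rewrite /w'; case: ifP; rewrite ?eqxx.
- by rewrite -w1 sumG.
move: wL; rewrite sumG /L; congr (integer_matrices _).
apply: eq_bigr => i _; apply: eq_bigr => j _.
by rewrite /w'; case: ifP; rewrite ?scale0r.
Qed.

Lemma lattice_points_neq0 : A != fset0.
Proof.
(* The matrix proportional to [r i * c j] is a real point of the polytope, which is the hull of its
   lattice points. *)
have Ppt : P (\matrix_(i, j) ((r i)%:~R * (c j)%:~R / (\sum_k r k)%:~R)).
  have sr0 : 0 < \sum_k r k.
    rewrite (bigD1 i0) //=.
    by apply: ltr_pwDl => //; apply: sumr_ge0 => k _; apply: ltW.
  have s0 : ((\sum_k r k)%:~R : R) != 0 by rewrite intr_eq0 gt_eqF.
  split=> [i j|i|j].
  - by rewrite mxE divr_ge0 ?mulr_ge0 // ler0z ltW.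
  - under eq_bigr do rewrite mxE.
    by rewrite -mulr_suml -mulr_sumr -rmorph_sum /= -sum_rc mulfK.
  - under eq_bigr do rewrite mxE.
    by rewrite -!mulr_suml -rmorph_sum mulrAC divff ?mul1r.
by move: Ppt; rewrite hullA => /hullN0.
Qed.

Lemma transportation_quadratic_triangulation :
  exists T : set {fset 'M[R]_3}, quadratic_triangulation L P T.
Proof.
exists (clique A h); apply: quadratic_triangulation_cliques.
- by rewrite lattice_pointsE.
- exact: hullA.
- exact: lattice_points_neq0.
- exact: clique_exposed.
- exact: clique_integral_weights.
Qed.

End TransportationPolytope.

Theorem theorem1p9 (R : realType) (r c : 'I_3 -> int)
    (hr : forall i, 0 < r i) (hc : forall j, 0 < c j)
    (hrc : \sum_i r i = \sum_j c j)
    (hB : ~ exists k : int,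
            [/\ 0 < k, forall i, r i = k & forall j, c j = k]) :
  exists T : set {fset 'M[R]_3},
    quadratic_triangulation (@integer_matrices R 3 3)
      (@transportation_polytope R 3 3 r c) T.
Proof.
(* If every row sum were 1, the total 3 and positivity would force all column sums to be 1, the
   excluded case [k = 1]. *)
have [i0 ri0] : exists i0, 2 <= r i0.
  apply: contrapT => nr; apply: hB; exists 1.
  have r1 i : r i = 1.
    have := hr i; have : ~ 2 <= r i by move=> r2; apply: nr; exists i.
    lia.
  split=> //; move: hrc; rewrite !sum_ord3 !r1 => hc3.
  by have := hc o0; have := hc o1; have := hc o2 => ? ? ?; apply: ord3P; lia.
have [i1 [i2 [i01 i02 i12]]] : exists i1 i2, [/\ i0 != i1, i0 != i2 & i1 != i2].
  by move: i0 {ri0}; apply: ord3P; [exists o1, o2 | exists o0, o2 | exists o0, o1].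
exact: transportation_quadratic_triangulation i01 i02 i12 hr hc hrc ri0.
Qed.
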